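(* The following two statements are equivalent: (i) for every finite loopless planar graph $G$, every lattice point of $3\,\mathrm{Cut}^\square(G)$ is a sum of $3$ lattice points of $\mathrm{Cut}^\square(G)$; (ii) the four color theorem: every finite loopless planar graph admits a proper vertex coloring with $4$ colors.
   Context: A cut $A\mid B$ of $G=(V,E)$ is an unordered partition $A\sqcup B=V$ ($A$ or $B$ may be empty). It determines $\delta_{A\mid B}\in\mathbb{R}^{|E|}$ with $\delta_{A\mid B}(e)=1$ if the edge $e$ has one endpoint in $A$ and one in $B$, and $\delta_{A\mid B}(e)=0$ otherwise. The cut polytope $\mathrm{Cut}^\square(G)$ is the convex hull of all $\delta_{A\mid B}$; its lattice points are exactly the cut vectors. A lattice point of $k\,\mathrm{Cut}^\square(G)$ means a point of $k\,\mathrm{Cut}^\square(G)$ lying in the lattice $L\subset\mathbb{Z}^{|E|}$ generated by all cut vectors $\delta_{A\mid B}$. *)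

(* Defs.v *)
From HB Require Import structures.
From mathcomp Require Import all_boot all_order all_algebra.
From mathcomp Require Import all_classical all_reals all_analysis.

Set Implicit Arguments.
Unset Strict Implicit.
Unset Printing Implicit Defensive.

Import Order.TTheory GRing.Theory Num.Theory.
Import numFieldNormedType.Exports.

Local Open Scope classical_set_scope.
Local Open Scope ring_scope.

(* Finite undirected multigraphs: parallel edges are allowed. The order of the
   two ends of an edge is an artefact of the encoding; every notion below is
   symmetric in them. *)
Record mgraph := MGraph {
  vertex : finType;
  edge : finType;
  end1 : edge -> vertex;
  end2 : edge -> vertex
}.

Definition loopless (G : mgraph) : Prop :=
  forall e : edge G, end1 e != end2 e.

(* Crossing-free drawings in the real plane, edges being continuous arcs
   parametrized by [0, 1]. Injectivity is only required on ]0, 1[ so that a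
   loop may be drawn as a simple closed curve; for a non-loop edge, injectivity
   on [0, 1] follows from the remaining clauses. *)
Definition plane_drawing (R : realType) (G : mgraph)
    (pos : vertex G -> R * R) (arc : edge G -> R -> R * R) : Prop :=
  [/\ injective pos,
      forall e, [/\ {within `[0, 1], continuous (arc e)},
                    arc e 0 = pos (end1 e),
                    arc e 1 = pos (end2 e) &
                    {in `]0, 1[ &, injective (arc e)}],
      forall e v, {in `]0, 1[, forall t, arc e t <> pos v} &
      forall e f, e != f -> {in `]0, 1[ &, forall s t, arc e s <> arc f t}].

Definition planar (R : realType) (G : mgraph) : Prop :=
  exists pos arc, @plane_drawing R G pos arc.

Definition four_colorable (G : mgraph) : Prop :=
  exists c : vertex G -> 'I_4, forall e : edge G, c (end1 e) != c (end2 e).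

(* The cut A | ~: A; A and ~: A give the same vector. *)
Definition cut_vector (R : realType) (G : mgraph) (A : {set vertex G}) :
    {ffun edge G -> R} :=
  [ffun e => ((end1 e \in A) != (end2 e \in A))%:R].

Definition cut_polytope (R : realType) (G : mgraph) : set {ffun edge G -> R} :=
  [set x | exists lam : {set vertex G} -> R,
    [/\ forall A, 0 <= lam A,
        \sum_A lam A = 1 &
        forall e, x e = \sum_A lam A * cut_vector R A e]].

Definition cut_lattice (R : realType) (G : mgraph) : set {ffun edge G -> R} :=
  [set x | exists c : {set vertex G} -> int, x = \sum_A cut_vector R A *~ c A].

Definition dilated_cut_polytope (R : realType) (G : mgraph) (k : nat) :
    set {ffun edge G -> R} :=
  [set y *+ k | y in @cut_polytope R G].

Definition dilate_lattice_points (R : realType) (G : mgraph) (k : nat) :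
    set {ffun edge G -> R} :=
  @dilated_cut_polytope R G k `&` @cut_lattice R G.

(* Main.v *)
Require Import Defs.
From HB Require Import structures.
From mathcomp Require Import all_boot all_order all_algebra.
From mathcomp Require Import all_classical all_reals all_analysis.
From mathcomp Require Import ring lra zify.

Set Implicit Arguments.
Unset Strict Implicit.
Unset Printing Implicit Defensive.

(** A lattice point of 3 Cut(G) is congruent mod 2 to a cut D; switching at D
    turns it into a point with values in {0, 2}. Contracting the edges with value
    0 leaves a planar loopless graph on which the value is constantly 2, and 2 is
    a sum of three cuts exactly when the graph is 4-colorable (the colors being
    the elements of F_2^2).

    So (ii) implies (i) as soon as contraction preserves planarity of continuous
    drawings: make the arcs straight near the vertices, replace the contracted
    arc by a simple polygon, and shrink it one segment at a time by a map of the
    plane preserving the rays from one end of the segment.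

    For (i) implies (ii), one must know that the constant vector 2/3 lies in
    Cut(G). Take the dual of a polygonal drawing: its vertices are the mod 2
    winding functions of points on the two sides of edges. As G has no loops,
    the dual has no bridges, hence the constant vector 1/3 satisfies the
    constraints of the Edmonds-Johnson polyhedron of T-joins, T being the set of
    vertices of odd degree of the dual. Complements of T-joins are cuts of G,
    so some average of cuts is at least 2/3 everywhere; in an edge-minimal
    counterexample G, the 4-colorings of the graphs G - e bring it down to 2/3. *)

Import Order.TTheory GRing.Theory Num.Theory.
Import numFieldNormedType.Exports.
Local Open Scope ring_scope.

(** * The dominant of the T-join polytope *)

(** Faces of the dual are told apart only by parities: two points are in the same face when every
    even edge set of [G] winds around them with the same parity. Two facts link this dual to [G]:
    its cuts are even edge sets of [G], and every even edge set is such a cut. By the first, an odd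
    dual cut cannot consist of one edge, since that edge would be a loop of [G]; so it has at least
    3 edges, whence 1/3. By the second, the complement of a T-join meets every even edge set evenly,
    because a T-join has the parity of each dual cut; over F_2 this makes it a cut. The number 2/3
    is the lattice point 2 divided by the dilation factor 3. Edmonds-Johnson describes only the
    dominant of the T-join polytope, so the average of cuts that it yields exceeds 2/3 by an unknown
    amount on each edge. The topological obstacle is that arcs are arbitrary continuous curves.
    Polygons are found in thin tubes around them, but tubes of edges with a common end would overlap
    near that end; hence the straightening there. *)

Section Joins.
Variables (R : realFieldType) (E : finType).

Section Graph.
Variables (V : finType) (a b : E -> V) (T : V -> bool).

Definition crosses (S : {set V}) (e : E) : bool := (a e \in S) (+) (b e \in S).

Definition odd_set (S : {set V}) : bool := \big[addb/false]_(v in S) T v.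

Definition join_at (J : {set E}) (S : {set V}) : Prop :=
  \big[addb/false]_(e in J) crosses S e = odd_set S.

Definition feasible (x : E -> R) : Prop :=
  (forall e, 0 <= x e) /\
  (forall S, odd_set S -> 1 <= \sum_(e | crosses S e) x e).

(* [P] is the family of sets on which the parity condition is required: all sets
   for T-joins, the saturated ones for T-joins of a contraction. *)
Definition dominates (P : {set V} -> Prop) (x : E -> R) : Prop :=
  exists (I : finType) (w : I -> R) (K : I -> {set E}),
    [/\ forall i, 0 <= w i, \sum_i w i = 1,
        forall i S, 0 < w i -> P S -> join_at (K i) S
      & forall e, \sum_(i | e \in K i) w i <= x e].

Definition symd (S S' : {set V}) : {set V} := [set v | (v \in S) (+) (v \in S')].

Lemma crosses_symd S S' e : crosses (symd S S') e = crosses S e (+) crosses S' e.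
Proof. by rewrite /crosses !inE addbACA. Qed.

Lemma odd_set_symd S S' : odd_set (symd S S') = odd_set S (+) odd_set S'.
Proof.
rewrite /odd_set !(big_mkcond (fun v => v \in _)) -big_split /=.
by apply: eq_bigr => v _; rewrite inE; case: (v \in S); case: (v \in S'); case: (T v).
Qed.

Lemma join_at_symd J S S' : join_at J S -> join_at J S' -> join_at J (symd S S').
Proof.
rewrite /join_at odd_set_symd => <- <-; rewrite -big_split /=.
by apply: eq_bigr => e _; rewrite crosses_symd.
Qed.

Lemma crosses_setC S e : crosses (finset.setC S) e = crosses S e.
Proof. by rewrite /crosses !inE; case: (_ \in S); case: (_ \in S). Qed.

Lemma crosses_setT e : crosses [set: V]%SET e = false.
Proof. by rewrite /crosses !inE. Qed.

(** No edge crosses [V] itself, so a feasible point can exist only if [T] is odd at an even number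
    of vertices. *)
Lemma odd_setC x S : feasible x -> odd_set (finset.setC S) = odd_set S.
Proof.
move=> [_ fx].
have -> : finset.setC S = symd S [set: V]%SET.
  by apply/setP => v; rewrite !inE; case: (v \in S).
rewrite odd_set_symd; case oT: (odd_set [set: V]%SET); last by rewrite addbF.
have := fx _ oT; rewrite big_pred0 ?ler10 // => e; exact: crosses_setT.
Qed.

Lemma dominates_le P x y :
  dominates P x -> (forall e, x e <= y e) -> dominates P y.
Proof.
move=> [I [w [K [w0 w1 wJ wx]]]] xy; exists I, w, K; split=> // e.
exact: le_trans (wx e) (xy e).
Qed.

Lemma dominates_convex P x y t : 0 <= t <= 1 -> dominates P x -> dominates P y ->
  dominates P (fun e => t * x e + (1 - t) * y e).
Proof.
move=> /andP[t0 t1] [I [w [K [w0 w1 wJ wx]]]] [I' [w' [K' [w0' w1' wJ' wx']]]].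
have t1' : 0 <= 1 - t by rewrite subr_ge0.
exists (I + I')%type,
  (fun i => match i with inl i => t * w i | inr i => (1 - t) * w' i end),
  (fun i => match i with inl i => K i | inr i => K' i end); split.
- by case=> i; rewrite mulr_ge0.
- by rewrite big_sumType /= -!mulr_sumr w1 w1' !mulr1 addrC subrK.
- case=> i S wi PS.
    by apply: wJ => //; rewrite lt_def w0 andbT; apply: contraTneq wi => ->; rewrite mulr0 ltxx.
  by apply: wJ' => //; rewrite lt_def w0' andbT; apply: contraTneq wi => ->; rewrite mulr0 ltxx.
- move=> e; rewrite big_sumType /= -!mulr_sumr.
  by rewrite lerD // ler_wpM2l.
Qed.

Lemma dominates_of_join (J : {set E}) (P : {set V} -> Prop) (x : E -> R) : (forall e, 0 <= x e) ->
  (forall e, e \in J -> 1 <= x e) -> (forall S, P S -> join_at J S) ->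
  dominates P x.
Proof.
move=> x0 xJ JP; exists unit, (fun=> 1), (fun=> J); split=> //.
- by rewrite big_const card_unit /= addr0.
- by move=> _ S _; apply: JP.
- move=> e; have [eJ|eJ] := boolP (e \in J).
    by rewrite big_const card_unit /= addr0; apply: xJ.
  by rewrite big_pred0.
Qed.

(* The constraints of [feasible] as affine functions of [x]. *)
Definition slack (x : E -> R) (k : E + {set V}) : R :=
  match k with
  | inl e => x e
  | inr X => if odd_set X then \sum_(e | crosses X e) x e - 1 else 1
  end.

Definition slope (d : E -> R) (k : E + {set V}) : R :=
  match k with
  | inl e => d e
  | inr X => if odd_set X then \sum_(e | crosses X e) d e else 0
  end.

Lemma slackD x d s k : slack (fun e => x e + s * d e) k = slack x k + s * slope d k.
Proof.
case: k => [e|X] //=; case: ifP => _; last by rewrite mulr0 addr0.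
by rewrite big_split /= -mulr_sumr addrAC.
Qed.

Lemma feasibleP x : feasible x <-> forall k, 0 <= slack x k.
Proof.
split=> [[x0 xS] [e|X] //=|k0].
  by case: ifP => // oS; rewrite subr_ge0; apply: xS.
split=> [e|S oS]; first exact: k0 (inl e).
by have := k0 (inr S); rewrite /= oS subr_ge0.
Qed.

Definition num_slack (x : E -> R) := #|[set k | slack x k != 0]|.

(** The ratio test of linear programming: the step is the least ratio of slack to rate of decrease.
    Tight constraints stay tight and a minimizing one becomes tight; the coordinate with [d e < 0]
    guarantees that some constraint decreases. *)
Lemma feasible_move x d : feasible x ->
  (forall k, slack x k = 0 -> slope d k = 0) -> (exists e, d e < 0) ->
  exists2 s, 0 < s & feasible (fun e => x e + s * d e) /\
    (num_slack (fun e => x e + s * d e)%R < num_slack x)%N.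
Proof.
move=> /feasibleP fx xd [e0 de0].
pose ratio k := slack x k / - slope d k.
have [k dk kmin] := @Order.TotalTheory.arg_minP _ _ _ (inl e0 : E + {set V})
  [pred k | slope d k < 0] ratio de0.
rewrite /= in dk kmin.
have pos k' : slope d k' < 0 -> 0 < slack x k'.
  move=> dk'; rewrite lt_def fx andbT; apply: contraTneq dk' => /xd ->.
  by rewrite ltxx.
have rk : 0 < ratio k by rewrite divr_gt0 ?pos ?oppr_gt0.
exists (ratio k) => //.
have fs : feasible (fun e => x e + ratio k * d e).
  apply/feasibleP => k'; rewrite slackD.
  have [dk'|dk'] := ltP (slope d k') 0; last by rewrite addr_ge0 // mulr_ge0 // ltW.
  have := kmin k' dk'; rewrite {2}/ratio ler_pdivlMr ?oppr_gt0 //.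
  by rewrite mulrN -subr_ge0 opprK.
split=> //; apply/proper_card/fintype.properP; split.
  apply/fintype.subsetP => k'; rewrite !inE slackD; apply: contraNneq => xk'.
  by rewrite xk' (xd _ xk') mulr0 addr0.
exists k; rewrite !inE ?slackD; first by rewrite gt_eqF ?pos.
by rewrite negbK /ratio invrN mulrN mulNr mulfVK ?subrr // lt_eqF.
Qed.

End Graph.

(** * Contraction of vertex sets in the T-join problem *)

Section Contraction.
Variables (V : finType) (a b : E -> V) (T : V -> bool).

Section Map.
Variables (V' : finType) (p : V -> V').

Definition push_parity (o : V') : bool := \big[addb/false]_(v | p v == o) T v.

Lemma odd_set_push S : odd_set push_parity S = odd_set T (p @^-1: S).
Proof.
rewrite /odd_set /push_parity (partition_big p (mem S)) /=; last first.
  by move=> v; rewrite inE.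
apply: eq_bigr => o oS; apply: eq_bigl => v; rewrite inE.
by case: eqP => [->|]; rewrite ?oS ?andbF.
Qed.

Lemma crosses_push S e :
  crosses (p \o a) (p \o b) S e = crosses a b (p @^-1: S) e.
Proof. by rewrite /crosses !inE. Qed.

Lemma feasible_push x : feasible a b T x ->
  feasible (p \o a) (p \o b) push_parity x.
Proof.
move=> [x0 xS]; split=> // S; rewrite odd_set_push => /xS.
by rewrite (eq_bigl _ _ (crosses_push S)).
Qed.

Lemma join_at_push J S : join_at (p \o a) (p \o b) push_parity J S <->
  join_at a b T J (p @^-1: S).
Proof. by rewrite /join_at odd_set_push (eq_bigr _ (fun e _ => crosses_push S e)). Qed.

End Map.

(** [None] is the vertex into which [S] is contracted. Edges inside [S] are kept as loops, which
    cross no set. *)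
Definition contract (S : {set V}) (v : V) : option {v | v \notin S} := insub v.

Lemma contract_preim (S S' : {set V}) : (S \subset S') || [disjoint S & S'] ->
  contract S @^-1: (contract S @: S') = S'.
Proof.
move=> SS'; apply/setP => v; rewrite inE; apply/imsetP/idP => [[w wS' vw]|vS'].
  move: vw; rewrite /contract.
  case: (insubP _ v) => [v' _ <-|vS]; case: (insubP _ w) => [w' _ ww'|wS] //.
    by move=> [->]; rewrite ww'.
  move: vS wS; rewrite !negbK => vS wS _; case/orP: SS' => [/fintype.subsetP/(_ _ vS)//|].
  by move=> /pred0P/(_ w); rewrite /= wS wS'.
by exists v.
Qed.

Lemma card_contract (S : {set V}) :
  (1 < #|S|)%N -> (#|{: option {v | v \notin S}}| < #|V|)%N.
Proof.
move=> S1; rewrite card_option card_sig -(cardsC S).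
have -> : #|[pred v | v \notin S]| = #|finset.setC S|.
  by apply: eq_card => v; rewrite finset.in_setC.
by move: S1; lia.
Qed.

Lemma dominates_contract (S : {set V}) x : feasible a b T x -> (1 < #|S|)%N ->
  (forall (V' : finType) (a' b' : E -> V') (T' : V' -> bool) (y : E -> R),
     (#|V'| < #|V|)%N -> feasible a' b' T' y -> dominates a' b' T' (fun=> True) y) ->
  dominates a b T (fun S' => (S \subset S') || [disjoint S & S']) x.
Proof.
move=> fx S1 IH.
have [I [w [K [w0 w1 wJ wx]]]] :=
  IH _ _ _ _ _ (card_contract S1) (feasible_push (contract S) fx).
exists I, w, K; split=> // i S' wi SS'.
by rewrite -(contract_preim SS'); apply/join_at_push/wJ.
Qed.

End Contraction.

Section Toggle.
Variables (V : finType) (a b : E -> V) (T : V -> bool) (e0 : E).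

Definition toggle (J : {set E}) : {set E} := [set e | (e \in J) (+) (e == e0)].

Lemma crosses_toggle (J : {set E}) S :
  \big[addb/false]_(e in toggle J) crosses a b S e =
  (\big[addb/false]_(e in J) crosses a b S e) (+) crosses a b S e0.
Proof.
rewrite -[X in _ = _ (+) X](big_pred1_eq addb e0 (crosses a b S)).
rewrite !(big_mkcond (fun e => e \in _)) (big_mkcond (pred1 e0)) -big_split /=.
by apply: eq_bigr => e _; rewrite !inE; case: (e \in J); case: (e == e0); rewrite ?addbb ?addbF.
Qed.

(** The edge [e0] crosses no saturated set, so its membership in each [K i] can be reset to repair
    the parity at the single vertex [a e0]. Modulo 2 every unsaturated set is this vertex plus a
    saturated set, and the weight of [e0] is at most 1 in any case. *)
Lemma dominates_lift x : a e0 != b e0 -> 1 <= x e0 ->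
  dominates a b T (fun S => ([set a e0; b e0]%SET \subset S) ||
                            [disjoint [set a e0; b e0]%SET & S]) x ->
  dominates a b T (fun=> True) x.
Proof.
move=> ab0 x1 [I [w [K [w0 w1 wJ wx]]]].
pose u := [set a e0]%SET; pose ok J := join_at a b T J u.
pose fix_at J := if `[< ok J >] then J else toggle J.
have fixE J e : e != e0 -> (e \in fix_at J) = (e \in J).
  by move=> /negPf ee0; rewrite /fix_at; case: ifP => // _; rewrite inE ee0 addbF.
have fix_at_u J : join_at a b T (fix_at J) u.
  rewrite /fix_at; case: asboolP => // nok; rewrite /join_at crosses_toggle.
  have -> : crosses a b u e0 = true.
    by rewrite /crosses !inE eqxx (eq_sym _ (a _)) (negPf ab0).
  by move: nok; rewrite /ok /join_at; case: (\big[_/_]_(e in J) _); case: (odd_set _ _).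
have fix_sat J S : crosses a b S e0 = false -> join_at a b T J S ->
    join_at a b T (fix_at J) S.
  rewrite /fix_at; case: ifP => // _ c0.
  by rewrite /join_at crosses_toggle c0 addbF.
exists I, w, (fun i => fix_at (K i)); split=> //.
- move=> i S wi _.
  have satP (S' : {set V}) : (a e0 \in S') = (b e0 \in S') -> join_at a b T (fix_at (K i)) S'.
    move=> abS; apply: fix_sat; first by rewrite /crosses abS addbb.
    apply: wJ => //; apply/orP; case aS: (a e0 \in S').
      left; apply/fintype.subsetP => v; rewrite !inE => /orP[]/eqP->//.
      by rewrite -abS.
    right; apply/pred0P => v /=; apply/negbTE/negP => /andP[]; rewrite !inE.
    by move=> /orP[]/eqP->; rewrite -?abS aS.
  have [//|abS] := eqVneq (a e0 \in S) (b e0 \in S); first exact: satP.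
  have -> : S = symd (symd S u) u.
    by apply/setP => v; rewrite !inE -addbA addbb addbF.
  apply: join_at_symd => //; apply: satP.
  rewrite !inE eqxx (eq_sym _ (a e0)) (negPf ab0) addbF.
  by case: (_ \in _) (_ \in _) abS => [] [].
- move=> e; have [->|ee0] := eqVneq e e0.
    apply: le_trans x1; rewrite -w1 [leRHS](bigID (fun i => e0 \in fix_at (K i))) /=.
    by rewrite lerDl sumr_ge0.
  by rewrite (eq_bigl _ _ (fun i => fixE (K i) e ee0)).
Qed.

End Toggle.

(** * Gluing along a tight odd set *)

Section Glue.
Variables (V : finType) (a b : E -> V) (T : V -> bool) (x : E -> R) (S : {set V}).
Hypotheses (oS : odd_set T S) (tS : \sum_(e | crosses a b S e) x e = 1).

Lemma big_addb_odd (J : {set E}) (c : E -> bool) :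
  \big[addb/false]_(e in J) c e = odd #|[set e in J | c e]%SET|.
Proof.
rewrite -sum1_card (big_morph odd oddD (erefl _)) big_mkcond [RHS]big_mkcond /=.
by apply: eq_bigr => e _; rewrite inE; case: (e \in J); case: (c e).
Qed.

(* Averaged over the combination, the number of edges across a tight odd set is
   at most 1, while each of these numbers is odd. *)
Lemma tight_marginals (I : finType) (w : I -> R) (K : I -> {set E}) :
  (forall i, 0 <= w i) -> \sum_i w i = 1 ->
  (forall i, 0 < w i -> join_at a b T (K i) S) ->
  (forall e, \sum_(i | e \in K i) w i <= x e) ->
  (forall i, 0 < w i -> exists f, forall e, crosses a b S e && (e \in K i) = (e == f)) /\
  (forall e, crosses a b S e -> \sum_(i | e \in K i) w i = x e).
Proof.
move=> w0 w1 wJ wx; pose n i := #|[set e in K i | crosses a b S e]%SET|.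
have n1 i : 0 < w i -> (0 < n i)%N.
  by move=> /wJ; rewrite /join_at oS big_addb_odd -/(n i); case: (n i).
have sumn : \sum_(e | crosses a b S e) \sum_(i | e \in K i) w i = \sum_i w i * (n i)%:R.
  rewrite (exchange_big_dep predT) //=; apply: eq_bigr => i _.
  rewrite sumr_const mulr_natr; congr (_ *+ _).
  by apply: eq_card => e; rewrite !inE andbC.
have gew i : w i <= w i * (n i)%:R.
  have := w0 i; rewrite le_eqVlt => /predU1P[<-|wi]; first by rewrite mul0r.
  by rewrite ler_peMr // ler1n n1.
have sum1 : \sum_(e | crosses a b S e) \sum_(i | e \in K i) w i = 1.
  apply/le_anti/andP; split; first by rewrite -tS; apply: ler_sum.
  by rewrite sumn -{1}w1; apply: ler_sum.
split=> [i wi|e ce].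
  have /psumr_eq0P H : \sum_i (w i * (n i)%:R - w i) = 0.
    by rewrite big_split /= sumrN -sumn sum1 w1 subrr.
  have /eqP : w i * (n i)%:R - w i = 0 by apply: H => // j _; rewrite subr_ge0.
  have wi0 : w i != 0 by rewrite gt_eqF.
  rewrite subr_eq0 -[X in _ == X]mulr1 (inj_eq (mulfI wi0)).
  rewrite pnatr_eq1 => /cards1P[f Kf]; exists f => e.
  by move/setP/(_ e): Kf; rewrite !inE andbC.
have /psumr_eq0P H : \sum_(e | crosses a b S e) (x e - \sum_(i | e \in K i) w i) = 0.
  by rewrite big_split /= sumrN tS sum1 subrr.
apply/esym/eqP; rewrite -subr_eq0; apply/eqP; apply: H => // f _.
by rewrite subr_ge0.
Qed.

(** Members of positive weight in either combination contain exactly one edge across [S], and both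
    combinations give each such edge [f] the total weight [x f]. So they can be coupled through
    their common edge. *)
Lemma dominates_glue : (forall e, 0 <= x e) ->
  dominates a b T (fun S' => (S \subset S') || [disjoint S & S']) x ->
  dominates a b T (fun S' => (finset.setC S \subset S') || [disjoint finset.setC S & S']) x ->
  dominates a b T (fun=> True) x.
Proof.
move=> x0 [I [w [K [w0 w1 wJ wx]]]] [I' [w' [K' [w0' w1' wJ' wx']]]].
have [||||uK mK] // := @tight_marginals I w K.
  by move=> i wi; apply: wJ => //; rewrite fintype.subxx.
have [||||uK' mK'] // := @tight_marginals I' w' K'.
  by move=> i wi; apply: wJ' => //; rewrite orbC -finset.setI_eq0 finset.setIC finset.setICr eqxx.
pose both f i j := [&& crosses a b S f, f \in K i & f \in K' j].
(* Given [f], the two members are drawn independently with conditional weights [w i / x f] and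
   [w' j / x f]; multiplying by the weight [x f] of [f] gives the summand. At positive weights at
   most one [f] contributes. *)
pose W i j := w i * w' j * \sum_(f | both f i j) (x f)^-1.
have W0 i j : 0 <= W i j.
  by rewrite !mulr_ge0 // sumr_ge0 // => f _; rewrite invr_ge0.
have WK i : \sum_j W i j = w i.
  have := w0 i; rewrite le_eqVlt => /predU1P[wi|wi].
    by rewrite -wi big1 // => j _; rewrite /W -wi !mul0r.
  have [f uf] := uK _ wi; have /andP[cf fK] : crosses a b S f && (f \in K i) by rewrite uf.
  have xf : 0 < x f.
    rewrite -mK // (bigD1 i) //=; apply: ltr_pwDl => //; exact: sumr_ge0.
  have -> : \sum_j W i j = \sum_(j | f \in K' j) w i * w' j * (x f)^-1.
    rewrite [RHS]big_mkcond; apply: eq_bigr => j _; rewrite /W.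
    rewrite (eq_bigl (fun e => (e == f) && (f \in K' j))); last first.
      by move=> e; rewrite /both andbA uf; case: eqP => [->|].
    case: ifP => fK'; first by rewrite (eq_bigl (pred1 f)) ?big_pred1_eq // => e; rewrite andbT.
    by rewrite big_pred0 ?mulr0 // => e; rewrite andbF.
  by rewrite -mulr_suml -mulr_sumr mK' // mulfK ?gt_eqF.
have WK' j : \sum_i W i j = w' j.
  have := w0' j; rewrite le_eqVlt => /predU1P[wj|wj].
    by rewrite -wj big1 // => i _; rewrite /W -wj mulr0 mul0r.
  have [f uf] := uK' _ wj; have /andP[cf fK'] : crosses a b S f && (f \in K' j) by rewrite uf.
  have xf : 0 < x f.
    rewrite -mK' // (bigD1 j) //=; apply: ltr_pwDl => //; exact: sumr_ge0.
  have -> : \sum_i W i j = \sum_(i | f \in K i) w i * w' j * (x f)^-1.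
    rewrite [RHS]big_mkcond; apply: eq_bigr => i _; rewrite /W.
    rewrite (eq_bigl (fun e => (e == f) && (f \in K i))); last first.
      by move=> e; rewrite /both andbCA uf; case: eqP => [->|]; rewrite ?andbT ?andbF.
    case: ifP => fK; first by rewrite (eq_bigl (pred1 f)) ?big_pred1_eq // => e; rewrite andbT.
    by rewrite big_pred0 ?mulr0 // => e; rewrite andbF.
  by rewrite -!mulr_suml mK // mulrC mulrA mulVf ?mul1r ?gt_eqF.
(* [K] has the right parity on sets disjoint from [S], [K'] on sets inside [S]. On the edges across
   [S], which matter to both, the two members agree when their joint weight is positive. *)
exists (I * I')%type, (fun p => W p.1 p.2),
  (fun p => [set e | if (a e \in S) && (b e \in S) then e \in K' p.2 else e \in K p.1]%SET).
split=> //.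
- by rewrite -(pair_bigA _ W) /= -w1; apply: eq_bigr.
- case=> i j X /= Wij _.
  have wi : 0 < w i.
    by rewrite lt_def w0 andbT; apply: contraTneq Wij => wi; rewrite /W wi !mul0r ltxx.
  have wj : 0 < w' j.
    by rewrite lt_def w0' andbT; apply: contraTneq Wij => wj; rewrite /W wj mulr0 mul0r ltxx.
  have [f /and3P[cf fK fK']] : exists f, both f i j.
    case: (pickP (fun f => both f i j)) => [f fP|nf]; first by exists f.
    by move: Wij; rewrite /W big_pred0 ?mulr0 ?ltxx.
  have KK' e : crosses a b S e -> (e \in K i) = (e \in K' j).
    move=> ce; have [g ug] := uK _ wi; have [g' ug'] := uK' _ wj.
    have := ug e; have := ug' e; rewrite ce /= => -> ->.
    have := ug f; have := ug' f; rewrite cf fK fK' /= => /esym/eqP <- /esym/eqP <- //.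
  have -> : X = symd (X :&: S)%SET (X :&: finset.setC S)%SET.
    by apply/setP => v; rewrite !inE; case: (v \in X); case: (v \in S).
  apply: join_at_symd.
    have := wJ' j (X :&: S)%SET wj; rewrite -finset.setI_eq0 => wj'.
    rewrite /join_at -wj'; last first.
      by apply/orP; right; rewrite finset.setIC -finset.setIA finset.setICr finset.setI0 eqxx.
    rewrite big_mkcond [RHS]big_mkcond; apply: eq_bigr => e _.
    have := KK' e; rewrite /crosses !inE.
    case: (a e \in S); case: (b e \in S) => //= KK; try rewrite (KK isT) //.
    all: rewrite ?andbF; do ?case: ifP => //.
  have := wJ i (X :&: finset.setC S)%SET wi; rewrite -finset.setI_eq0 => wi'.
  rewrite /join_at -wi'; last first.
    by apply/orP; right; rewrite finset.setICA finset.setICr finset.setI0 eqxx.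
  rewrite big_mkcond [RHS]big_mkcond; apply: eq_bigr => e _; rewrite /crosses !inE.
  case: (a e \in S); case: (b e \in S) => //=.
  all: rewrite ?andbF; do ?case: ifP => //.
- move=> e; have [abS|abS] := boolP ((a e \in S) && (b e \in S)).
    rewrite (eq_bigl (fun p => true && (e \in K' p.2))); last by move=> p; rewrite inE abS.
    rewrite -(pair_big xpredT (fun j => e \in K' j) W) /= exchange_big /=.
    by rewrite (eq_bigr _ (fun j _ => WK' j)).
  rewrite (eq_bigl (fun p => (e \in K p.1) && true)); last first.
    by move=> p; rewrite inE (negPf abS) andbT.
  rewrite -(pair_big (fun i => e \in K i) xpredT W) /=.
  by rewrite (eq_bigr _ (fun i _ => WK i)).
Qed.

End Glue.

Section Spread.
Variable U : {set E}.

(** Extension by zero outside [U]: it turns the row vectors of linear algebra into directions in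
    [E -> R]. *)
Definition spread (v : 'rV[R]_#|U|) (e : E) : R :=
  \sum_i v 0 i * (e == enum_val i)%:R.

Lemma spread_val v i : spread v (enum_val i) = v 0 i.
Proof.
rewrite /spread (bigD1 i) //= eqxx mulr1 big1 ?addr0 // => j ji.
by rewrite (inj_eq enum_val_inj) eq_sym (negPf ji) mulr0.
Qed.

Lemma spread_out v e : e \notin U -> spread v e = 0.
Proof.
move=> eU; rewrite /spread big1 // => i _; case: eqP => [ee|]; rewrite ?mulr0 //.
by move: eU; rewrite ee enum_valP.
Qed.

Lemma sum_spread v (c : pred E) :
  \sum_(e | c e) spread v e = \sum_i v 0 i * (c (enum_val i))%:R.
Proof.
rewrite exchange_big; apply: eq_bigr => i _; rewrite -mulr_sumr; congr (_ * _).
rewrite big_mkcond (bigD1 (enum_val i)) //= eqxx big1 ?addr0; first by case: (c _).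
by move=> e /negPf ->; case: (c e).
Qed.

End Spread.

Lemma sum_nat_tight (I : finType) (A : {set I}) (F G : I -> nat) :
  (forall i, i \in A -> (F i <= G i)%N) ->
  (\sum_(i in A) G i <= \sum_(i in A) F i)%N -> forall i, i \in A -> F i = G i.
Proof.
move=> FG GF i iA; apply/eqP; rewrite eqn_leq FG //= leqNgt; apply: contraTN GF => lt.
rewrite -ltnNge (bigD1 i) //= [X in (_ < X)%N](bigD1 i) //= -addSn leq_add //.
by apply: leq_sum => j /andP[jA _]; apply: FG.
Qed.

Lemma in_sep (I : finType) (A : {set I}) (p : pred I) i :
  (i \in [set j in A | p j]%SET) = (i \in A) && p i.
Proof. by rewrite finset.in_set. Qed.

(** * Feasible points that are rigid for the vertex constraints *)

Section Rigid.
Variables (V : finType) (a b : E -> V) (T : V -> bool) (x : E -> R).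
Let inc v e := crosses a b [set v]%SET e.
Let U := [set e | x e != 0]%SET.
Let Tv := [set v | T v && (\sum_(e | inc v e) x e == 1)]%SET.
Hypotheses (fx : feasible a b T x) (ltx : forall e, a e != b e -> x e < 1)
  (rigid : forall d : E -> R, (forall e, e \notin U -> d e = 0) ->
     (forall v, v \in Tv -> \sum_(e | inc v e) d e = 0) -> forall e, d e = 0).

Let deg (F : {set E}) v := #|[set e in F | inc v e]%SET|.
Let ends e := #|[set v in Tv | inc v e]%SET|.

Let sum_deg (F : {set E}) : (\sum_(v in Tv) deg F v = \sum_(e in F) ends e)%N.
Proof.
rewrite (eq_bigr (fun v => \sum_(e in F | inc v e) 1)%N); last first.
  by move=> v _; rewrite sum1_card; apply: eq_card => e; rewrite !inE.
rewrite (exchange_big_dep (mem F)) /=; last by move=> v e _ /andP[].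
apply: eq_bigr => e eF; rewrite sum1_card; apply: eq_card => v.
by rewrite in_sep unfold_in /= eF.
Qed.

Let incE v e : inc v e = (a e == v) (+) (b e == v).
Proof. by rewrite /inc /crosses !inE. Qed.

Let ends_sub e : [set v in Tv | inc v e]%SET \subset [set a e; b e]%SET.
Proof.
apply/fintype.subsetP => v; rewrite in_sep incE finset.in_set2 => /andP[_].
by rewrite !(eq_sym v); case: (a e == v).
Qed.

Let ends2 e : (ends e <= 2)%N.
Proof.
apply: leq_trans (subset_leq_card (ends_sub e)) _.
by rewrite cards2; case: (_ == _).
Qed.

(** The values of the edges at [v] sum to 1 and each is below 1, so one support edge is not
    enough. *)
Let deg2 v : v \in Tv -> (2 <= deg U v)%N.
Proof.
rewrite inE => /andP[_ /eqP sx]; rewrite leqNgt; apply/negP => lt2.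
have sxU : \sum_(e in [set e in U | inc v e]%SET) x e = 1.
  rewrite -sx big_mkcond [RHS]big_mkcond; apply: eq_bigr => e _; rewrite !inE.
  by case: eqP => [->|] //=; case: ifP.
move: lt2; rewrite ltnS leq_eqVlt => /orP[/cards1P[e Ue]|].
  move: sxU; rewrite Ue big_set1 => x1.
  have : e \in [set e in U | inc v e]%SET by rewrite Ue inE.
  rewrite !inE incE => /andP[_ ince].
  have : x e < 1 by apply: ltx; apply: contraTneq ince => ->; rewrite addbb.
  by rewrite x1 ltxx.
rewrite ltnS leqn0 cards_eq0 => /eqP U0; move: sxU; rewrite U0 big_set0 => /eqP.
by rewrite eq_sym oner_eq0.
Qed.

Let M : 'M[R]_(#|U|, #|Tv|) := \matrix_(i, j) (inc (enum_val j) (enum_val i))%:R.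

Let mulM (v : 'rV[R]_#|U|) j : (v *m M) 0 j = \sum_(e | inc (enum_val j) e) spread v e.
Proof. by rewrite mxE sum_spread; apply: eq_bigr => i _; rewrite mxE. Qed.

Let free_M : row_free M.
Proof.
rewrite -kermx_eq0; apply/negP => /negP/rowV0Pn[v /sub_kermxP vM v0].
case/negP: v0; apply/eqP/rowP => i; rewrite mxE -spread_val; apply: rigid.
  by move=> e; apply: spread_out.
move=> w wT; have := mulM v (enum_rank_in wT w).
by rewrite vM mxE enum_rankK_in.
Qed.

Let leUT : (#|U| <= #|Tv|)%N.
Proof. by move: free_M; rewrite /row_free => /eqP <-; apply: rank_leq_col. Qed.

Let le_ends : (\sum_(e in U) ends e <= 2 * #|U|)%N.
Proof.
by rewrite mulnC -sum_nat_const; apply: leq_sum.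
Qed.

Let le_deg : (2 * #|Tv| <= \sum_(v in Tv) deg U v)%N.
Proof. by rewrite mulnC -sum_nat_const; apply: leq_sum => v /deg2. Qed.

(** Counting incidences in two ways bounds [#|Tv|] by [#|U|], and independence of the rows of [M]
    gives the converse. Equality everywhere makes the support a 2-regular graph on [Tv] and [M]
    invertible. *)
Let eqUT : #|U| = #|Tv|.
Proof.
apply/eqP; rewrite eqn_leq leUT /= -(leq_pmul2l (isT : 0 < 2)%N).
by apply: leq_trans le_deg _; rewrite sum_deg; exact: le_ends.
Qed.

Let deg_eq v : v \in Tv -> deg U v = 2%N.
Proof.
move=> vT; apply/esym.
apply: (@sum_nat_tight _ Tv (fun=> 2%N) (deg U)) vT; first exact: deg2.
by rewrite sum_nat_const mulnC -eqUT sum_deg.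
Qed.

Let ends_eq e : e \in U -> ends e = 2%N.
Proof.
apply: (@sum_nat_tight _ U ends (fun=> 2%N)) => [f _|]; first exact: ends2.
by rewrite sum_nat_const mulnC eqUT -sum_deg.
Qed.

Let ends_in e : e \in U -> [/\ a e \in Tv, b e \in Tv & a e != b e].
Proof.
move=> /ends_eq ee.
have /eqP ab : [set v in Tv | inc v e]%SET == [set a e; b e]%SET.
  by rewrite eqEcard ends_sub -/(ends e) ee cards2; case: (_ == _).
have : a e \in [set v in Tv | inc v e]%SET by rewrite ab !inE eqxx.
have : b e \in [set v in Tv | inc v e]%SET by rewrite ab !inE eqxx orbT.
rewrite !in_sep => /andP[bT _] /andP[aT].
rewrite incE eqxx (eq_sym (b e)) => ab'; split=> //.
Qed.

(** A nonzero [x] is supported on disjoint cycles with invertible incidence matrix. Solving for the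
    right-hand side that is 1 at [v0] and 0 elsewhere, the solution alternates in sign along the
    cycle of [v0] and is 1/2 on both edges at [v0], which makes that cycle odd: a [T]-odd set
    crossed by no edge of the support. *)
Lemma rigid_zero e : x e = 0.
Proof.
apply/eqP; have [//|xe] := boolP (x e == 0).
have [v0T _ _] : [/\ a e \in Tv, b e \in Tv & a e != b e] by apply: ends_in; rewrite inE.
set v0 := a e in v0T.
have [d dU dv] : exists2 d : E -> R, (forall e, e \notin U -> d e = 0) &
    forall v, v \in Tv -> \sum_(e | inc v e) d e = (v == v0)%:R.
  have full : row_full M by move: free_M; rewrite /row_free /row_full => /eqP ->; rewrite eqUT.
  have /submxP[D DM] := submx_full (delta_mx 0 (enum_rank_in v0T v0) : 'rV_#|Tv|) full.
  exists (spread D) => [f|v vT]; first exact: spread_out.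
  have := mulM D (enum_rank_in v0T v); rewrite enum_rankK_in // => <-.
  rewrite -DM mxE eqxx /=; congr (_%:R); congr (nat_of_bool _).
  apply/eqP/eqP => [E12|-> //].
  by rewrite -(enum_rankK_in v0T vT) E12 enum_rankK_in.
have two v : v \in Tv -> exists f g, [/\ f != g, f \in U, g \in U,
    (forall h, h \in U -> inc v h = (h == f) || (h == g)) & d f + d g = (v == v0)%:R].
  move=> vT; have /eqP := deg_eq vT; move/cards2P => [f [g [fg Ufg]]].
  have Uh h : (h \in U) && inc v h = (h == f) || (h == g).
    by move/setP/(_ h): Ufg; rewrite in_sep finset.in_set2.
  have /andP[fU _] : (f \in U) && inc v f by rewrite Uh eqxx.
  have /andP[gU _] : (g \in U) && inc v g by rewrite Uh eqxx orbT.
  exists f, g; split=> // [h hU|]; first by rewrite -Uh hU.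
  rewrite -dv // (bigID (mem U)) /= [X in _ = _ + X]big1 ?addr0; last first.
    by move=> h /andP[_ /dU].
  rewrite (eq_bigl (mem [set f; g]%SET)) ?big_setU1 ?big_set1 ?inE //=.
  by move=> h; rewrite andbC Uh !inE.
have parity (F : {set E}) : F \subset U ->
    \big[addb/false]_(v in Tv) odd (deg F v) = false.
  move=> FU; rewrite -(big_morph odd oddD (erefl : odd 0 = false)) sum_deg.
  rewrite (eq_bigr (fun=> 2%N)) ?sum_nat_const ?oddM ?andbF // => f fF.
  by apply: ends_eq; apply: (fintype.subsetP FU).
have degE (F : {set E}) v f g : F \subset U -> f != g ->
    (forall h, h \in U -> inc v h = (h == f) || (h == g)) ->
    odd (deg F v) = (f \in F) (+) (g \in F).
  move=> FU fg hv.
  have -> : deg F v = ((f \in F) + (g \in F))%N.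
    rewrite /deg -sum1_card (eq_bigl (fun h => (h \in [set f; g]%SET) && (h \in F))).
      rewrite big_mkcondr big_setU1 ?big_set1 ?inE //=; case: (f \in F); case: (g \in F).
    move=> h; rewrite in_sep finset.in_set2 andbC; apply/andP/andP => [[ih hF]|[ih hF]]; split=> //.
      by rewrite -hv // (fintype.subsetP FU).
    by rewrite hv // (fintype.subsetP FU).
  by rewrite oddD; case: (f \in F); case: (g \in F).
have same v f g : v \in Tv -> v != v0 -> d f + d g = (v == v0)%:R -> `|d f| = `|d g|.
  by move=> _ /negPf -> /eqP; rewrite addr_eq0 => /eqP ->; rewrite normrN.
have [f0 [g0 [fg0 f0U g0U inc0 dfg0]]] := two _ v0T.
rewrite eqxx mulr1n in dfg0.
(* At every vertex other than [v0] the two edges have the same absolute value of [d]. If it differed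
   at [v0], the edges with the absolute value of [d f0] would have odd degree at [v0] alone, against
   the handshake lemma. *)
have half : d f0 = 2^-1 /\ d g0 = 2^-1.
  have [nfg|nfg] := eqVneq `|d f0| `|d g0|.
    have : d f0 = d g0.
      have /eqP := nfg; rewrite eqr_norm2 => /orP[/eqP//|/eqP dN].
      by move: dfg0; rewrite dN addNr => /eqP; rewrite eq_sym oner_eq0.
    by move=> dd; move: dfg0; rewrite dd => dfg0; split; lra.
  pose F := [set h in U | `|d h| == `|d f0| ]%SET.
  have FU : F \subset U by apply/fintype.subsetP => h; rewrite in_sep => /andP[].
  have inF h : h \in U -> (h \in F) = (`|d h| == `|d f0|).
    by move=> hU; rewrite in_sep hU.
  have := parity _ FU; rewrite (bigD1 v0) //= (degE _ _ f0 g0) // !inF // eqxx.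
  rewrite eq_sym (negPf nfg) big1 // => v /andP[vT vv0].
  have [f [g [fg fU gU incv dfg]]] := two _ vT.
  by rewrite (degE _ _ f g) // !inF // (same v f g) // addbb.
pose isF h := `|d h| == 2^-1.
have isF_same v f g : v \in Tv -> f \in U -> g \in U -> inc v f -> inc v g -> isF f -> isF g.
  move=> vT fU gU; have [f1 [g1 [fg1 f1U g1U incv dfg]]] := two _ vT.
  have sfg : isF f1 = isF g1.
    have [vv0|vv0] := eqVneq v v0; last by rewrite /isF (same v f1 g1).
    have : inc v0 f1 by rewrite -vv0 incv // eqxx.
    have : inc v0 g1 by rewrite -vv0 incv // eqxx orbT.
    by rewrite !inc0 // => /orP[]/eqP-> /orP[]/eqP->; rewrite /isF ?half.1 ?half.2.
  by rewrite !incv // => /orP[]/eqP-> /orP[]/eqP->; rewrite ?sfg.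
(* [S] plays the part of the vertex set of the cycle of [v0]: by [isF_same] it is closed under
   adjacency, so no walk along the cycle has to be described. *)
pose S := [set v in Tv | [exists h in U, isF h && inc v h]]%SET.
pose J := [set h in U | d h == 2^-1]%SET.
have JU : J \subset U by apply/fintype.subsetP => h; rewrite in_sep => /andP[].
have inJ h : h \in U -> (h \in J) = (d h == 2^-1).
  by move=> hU; rewrite in_sep hU.
have inS v : (v \in S) = (v \in Tv) && [exists h in U, isF h && inc v h].
  by rewrite in_sep.
have v0S : v0 \in S.
  rewrite inS v0T; apply/existsP; exists f0; rewrite f0U inc0 // eqxx /isF half.1.
  by rewrite ger0_norm ?eqxx ?invr_ge0.
(* A vertex of [S] other than [v0] has one edge of value 1/2 and one of value -1/2; at [v0] both are
   1/2. So the degrees in [J] are odd exactly on [S] without [v0], and this set has even size. *)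
have oddS : odd_set T S.
  have := parity _ JU; rewrite (eq_bigr (fun v => (v \in S) (+) (v == v0))).
    rewrite big_split /= => par; have -> : odd_set T S = \big[addb/false]_(v in Tv) (v \in S).
      rewrite /odd_set big_mkcond [RHS]big_mkcond; apply: eq_bigr => v _.
      rewrite inS; case vT: (v \in Tv) => //=; case: ifP => // _.
      by move: vT; rewrite inE => /andP[->].
    move: par; rewrite [X in _ (+) X](bigD1 v0) //= eqxx [X in true (+) X]big1.
      by case: (\big[_/_]_(_ in _) _).
    by move=> v /andP[_ /negPf].
  move=> v vT; have [f [g [fg fU gU incv dfg]]] := two _ vT.
  rewrite (degE _ _ f g) // !inJ // inS vT /=.
  have -> : [exists h in U, isF h && inc v h] = isF f.
    apply/existsP/idP => [[h /and3P[hU hF hv]]|Ff].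
      by apply: (@isF_same v h f) => //; rewrite incv // eqxx.
    by exists f; rewrite fU Ff incv // eqxx.
  have h2 : (2^-1 : R) != - 2^-1 by rewrite gt_eqF // gtrN // invr_gt0.
  have [vv0|vv0] := eqVneq v v0.
    have : inc v0 f by rewrite -vv0 incv // eqxx.
    have : inc v0 g by rewrite -vv0 incv // eqxx orbT.
    rewrite !inc0 // => /orP[]/eqP-> /orP[]/eqP->; rewrite /isF ?half.1 ?half.2 eqxx;
    by rewrite ger0_norm ?eqxx ?invr_ge0.
  move: dfg; rewrite (negPf vv0) addbF => /eqP; rewrite addr_eq0 => /eqP dfg.
  rewrite /isF dfg normrN eqr_oppLR -[X in `|_| == X](@ger0_norm _ 2^-1) ?invr_ge0 //.
  rewrite eqr_norm2; have [->|gh] := eqVneq (d g) 2^-1; first by rewrite (negPf h2).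
  by rewrite addbF.
have [_ /(_ S oddS)] := fx; rewrite big1 ?ler10 // => h.
have [hU ch|] := boolP (h \in U); last by rewrite inE negbK => /eqP.
have [aT bT ab] := ends_in hU.
have inca : inc (a h) h by rewrite incE eqxx eq_sym (negPf ab).
have incb : inc (b h) h by rewrite incE eqxx (negPf ab).
have ss u w : u \in Tv -> w \in Tv -> inc u h -> inc w h -> u \in S -> w \in S.
  move=> uT wT iu iw; rewrite !inS uT wT /= => /existsP[g /and3P[gU gF gu]].
  by apply/existsP; exists h; rewrite hU iw (@isF_same u g h).
move: ch; rewrite /crosses.
case aS: (a h \in S); case bS: (b h \in S) => // _.
  by rewrite (ss (a h) (b h)) in bS.
by rewrite (ss (b h) (a h)) in aS.
Qed.

End Rigid.

(* Contract an edge of weight at least 1, or each side of a tight odd set with at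
   least two vertices on both sides; otherwise move [x] both ways along a
   direction on which all tight constraints vanish, until a new constraint
   becomes tight; if there is no such direction then [x = 0]. *)
Theorem feasible_dominates (V : finType) (a b : E -> V) (T : V -> bool) (x : E -> R) :
  feasible a b T x -> dominates a b T (fun=> True) x.
Proof.
have [n] := ubnP #|V|; elim: n => // n IHn in V a b T x *; rewrite ltnS => leVn.
have IHV (V' : finType) (a' b' : E -> V') (T' : V' -> bool) (y : E -> R) :
    (#|V'| < #|V|)%N -> feasible a' b' T' y -> dominates a' b' T' (fun=> True) y.
  by move=> V'V; apply: IHn; apply: leq_trans V'V _.
have [m] := ubnP (num_slack a b T x); elim: m => // m IHm in x *; rewrite ltnS => lem fx.
have [[e [abe xe]]|no_heavy] := pselect (exists e, a e != b e /\ 1 <= x e).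
  apply: (dominates_lift abe xe); apply: dominates_contract fx _ IHV.
  by rewrite cards2 abe.
have [[S [oS tS S1 S2]]|no_tight] := pselect (exists S : {set V}, [/\ odd_set T S,
    \sum_(e | crosses a b S e) x e = 1, (1 < #|S|)%N & (1 < #|finset.setC S|)%N]).
  by apply: (dominates_glue oS tS fx.1); apply: dominates_contract.
have fk := (feasibleP a b T x).1 fx.
have [[d [dk [e0 de0]]]|no_dir] := pselect (exists d : E -> R,
    (forall k, slack a b T x k = 0 -> slope a b T d k = 0) /\ exists e, d e != 0).
  wlog dneg : d dk de0 / exists e, d e < 0.
    move=> wl; have := de0; rewrite neq_lt => /orP[dn|dp].
      by apply: (wl d) => //; exists e0.
    apply: (wl (fun e => - d e)); last by exists e0; rewrite oppr_lt0.
      move=> [e|X] /dk /=; first by move=> ->; rewrite oppr0.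
      by case: ifP => // _; rewrite sumrN => ->; rewrite oppr0.
    by rewrite oppr_eq0.
  have [s s0 [fs ls]] := feasible_move fx dk dneg.
  have Ds := IHm _ (leq_trans ls lem) fs.
  (* If [d] has no positive coordinate, the forward step only decreases [x] and is enough. Otherwise
     [x] lies between a forward and a backward step. *)
  have [[e1 de1]|dle] := pselect (exists e, 0 < d e); last first.
    apply: dominates_le Ds _ => e; rewrite -lerBrDl subrr pmulr_rle0 // leNgt.
    by apply/negP => de; apply: dle; exists e.
  have [||s' s0' [fs' ls']] := feasible_move fx (d := fun e => - d e).
  - move=> [e|X] /dk /=; first by move=> ->; rewrite oppr0.
    by case: ifP => // _; rewrite sumrN => ->; rewrite oppr0.
  - by exists e1; rewrite oppr_lt0.
  have Ds' := IHm _ (leq_trans ls' lem) fs'.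
  have ss : 0 < s + s' by apply: addr_gt0.
  have t01 : 0 <= s' / (s + s') <= 1.
    by rewrite (divr_ge0 (ltW s0') (ltW ss)) /= ler_pdivrMr // mul1r lerDr ltW.
  apply: dominates_le (dominates_convex t01 Ds Ds') _ => e.
  rewrite le_eqVlt; apply/orP; left; apply/eqP; field; exact: lt0r_neq0.
(* By [no_tight], a tight odd set is now a single vertex or the complement of one, so a direction
   that vanishes on the tight vertex constraints and off the support vanishes on all tight
   constraints. *)
have x0 e : x e = 0.
  apply: (@rigid_zero V a b T x fx).
    by move=> f abf; rewrite ltNge; apply/negP => xf; apply: no_heavy; exists f.
  move=> d dU dT f; apply/eqP/negPn/negP => df; apply: no_dir; exists d.
  split; last by exists f.
  have tight1 v : odd_set T [set v]%SET ->
      \sum_(e | crosses a b [set v]%SET e) x e = 1 ->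
      \sum_(e | crosses a b [set v]%SET e) d e = 0.
    rewrite /odd_set big_set1 => Tv xv; apply: dT.
    by rewrite finset.in_set Tv xv eqxx.
  move=> [g|X] /=; first by move=> xg; apply: dU; rewrite finset.in_set xg eqxx.
  case: ifP => // oX /eqP; rewrite subr_eq0 => /eqP xX.
  have [X1|X1] := ltnP 1 #|X|; last first.
    have [/eqP X0|] := posnP #|X|.
      by move: oX; rewrite cards_eq0 in X0; rewrite (eqP X0) /odd_set big_set0.
    move=> X0; have /cards1P[v Xv] : #|X| == 1%N by rewrite eqn_leq X1.
    by move: oX xX; rewrite Xv; apply: tight1.
  have [X2|X2] := ltnP 1 #|finset.setC X|.
    by case: no_tight; exists X.
  have oX' : odd_set T (finset.setC X) by rewrite (odd_setC _ fx).
  rewrite -(eq_bigl _ _ (crosses_setC a b X)).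
  rewrite -(eq_bigl _ _ (crosses_setC a b X)) in xX.
  have [/eqP X0|X0] := posnP #|finset.setC X|.
    by move: oX'; rewrite cards_eq0 in X0; rewrite (eqP X0) /odd_set big_set0.
  have /cards1P[v Xv] : #|finset.setC X| == 1%N by rewrite eqn_leq X2.
  by move: oX' xX; rewrite Xv; apply: tight1.
apply: (@dominates_of_join _ _ _ _ finset.set0) => [e|e|S _].
- by rewrite x0.
- by rewrite finset.in_set0.
- rewrite /join_at big_set0; apply/esym/negbTE/negP => oS.
  by have [_ /(_ S oS)] := fx; rewrite big1 ?ler10.
Qed.

End Joins.

Local Open Scope classical_set_scope.

(** * Polygons and collapsing maps *)

Section Polygons.
Variable R : realType.
Local Notation P := (R * R)%type.
Implicit Types (p q c z : P) (l : seq P).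

Definition seg p q : set P := [set z | exists2 t : R, 0 <= t <= 1 & z = p + t *: (q - p)].

Lemma seg_start p q : seg p q p.
Proof. by exists 0; rewrite ?lexx ?ler01 // scale0r addr0. Qed.

Lemma seg_end p q : seg p q q.
Proof. by exists 1; rewrite ?lexx ?ler01 // scale1r addrC subrK. Qed.

Lemma addBK (V : zmodType) (x y : V) : x + y - x = y.
Proof. by rewrite addrAC subrr add0r. Qed.

Lemma seg_subl p q c : seg p q c -> seg p c `<=` seg p q.
Proof.
move=> [t /andP[t0 t1] ->] z [s /andP[s0 s1] ->]; exists (s * t).
  by rewrite mulr_ge0 //= mulr_ile1.
by rewrite addBK scalerA.
Qed.

Lemma seg_subr p q c : seg p q c -> seg c q `<=` seg p q.
Proof.
move=> [t /andP[t0 t1] ->] z [s /andP[s0 s1] ->]; exists (t + s * (1 - t)).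
  by apply/andP; split; nra.
have -> : q - (p + t *: (q - p)) = (1 - t) *: (q - p).
  by rewrite scalerBl scale1r opprD addrA.
by rewrite scalerA -addrA -scalerDl.
Qed.

Fixpoint poly p l : set P := if l is q :: l' then seg p q `|` poly q l' else [set p].

Lemma poly_start p l : poly p l p.
Proof. by case: l => [|q l] //; left; apply: seg_start. Qed.

Lemma poly_end p l : poly p l (last p l).
Proof. by elim: l p => [|q l IH] p //=; right. Qed.

Lemma path_continuous p q : continuous (fun t : R => p + t *: (q - p)).
Proof.
by move=> t; apply: cvgD; [exact: cvg_cst|apply: cvgZr_tmp; exact: cvg_id].
Qed.

Lemma compact_seg p q : compact (seg p q).
Proof.
have -> : seg p q = (fun t : R => p + t *: (q - p)) @` `[0, 1].
  apply/seteqP; split=> z [t].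
    by move=> t01 ->; exists t => //=; rewrite in_itv.
  by rewrite /= in_itv /= => t01 <-; exists t.
apply: continuous_compact; last exact: segment_compact.
exact/continuous_subspaceT/path_continuous.
Qed.

Lemma compact_poly p l : compact (poly p l).
Proof.
elim: l p => [|q l IH] p; first exact: compact_set1.
by rewrite /=; apply: compactU; [exact: compact_seg|exact: IH].
Qed.

Fixpoint simple p l : Prop :=
  if l is q :: l' then
    [/\ p <> q, forall z, seg p q z -> poly q l' z -> z = q & simple q l']
  else True.

Lemma simple_from p l c : simple p l -> poly p l c ->
  exists l', [/\ simple c l', last c l' = last p l & poly c l' `<=` poly p l].
Proof.
elim: l p => [|q l IH] p /=; first by move=> _ ->; exists [::]; split.
move=> [pq pql sl] cpl.
have [cq|ncq] := pselect (poly q l c).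
  have [l' [s' e' sub']] := IH _ sl cq.
  by exists l'; split=> // z /sub'; right.
have {cpl ncq} [cpq ncq] : seg p q c /\ ~ poly q l c by case: cpl.
exists (q :: l); split=> //=.
  split=> // [cq|z zcq]; first by apply: ncq; rewrite cq; apply: poly_start.
  by apply: pql; apply: seg_subr cpq _ zcq.
by move=> z [/(seg_subr cpq)|]; [left|right].
Qed.

Lemma first_hit p q (C : set P) : closed C -> C q ->
  exists2 c, seg p q c & C c /\ forall z, seg p c z -> C z -> z = c.
Proof.
move=> cC Cq; pose g t : P := p + t *: (q - p).
pose A := `[0, 1]%classic `&` g @^-1` C.
have cA : compact A.
  apply: compact_closedI; first exact: segment_compact.
  by apply: closed_comp => // t _; apply: path_continuous.
have A0 : A !=set0.
  exists 1; split; first by rewrite /= in_itv /= lexx ler01.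
  by rewrite /preimage /g /= scale1r addrC subrK.
have [|t] := compact_EVT_min A0 cA (f := id); first by apply: continuous_subspaceT => ?; exact: cvg_id.
rewrite inE => -[/= ]; rewrite in_itv /= => t01 Ct tmin.
exists (g t); first by exists t.
split=> // z [s /andP[s0 s1] zE] Cz.
have t0 : 0 <= t by case/andP: t01.
have t1 : t <= 1 by case/andP: t01.
have zg : z = g (s * t) by rewrite zE /g addBK scalerA.
have : t <= s * t.
  apply: tmin; rewrite inE; split; last by rewrite /preimage /= -zg.
  by rewrite /= in_itv /= mulr_ge0 // mulr_ile1.
by move=> ts; rewrite zg; congr g; apply/le_anti; rewrite ts andbT ler_piMl.
Qed.

(* The segment is followed only up to its first point on the polygon. *)
Lemma simple_cons p q l : simple q l -> exists l',
  [/\ simple p l', last p l' = last q l & poly p l' `<=` seg p q `|` poly q l].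
Proof.
move=> sl; have cl : closed (poly q l).
  by apply: compact_closed; [exact: norm_hausdorff|exact: compact_poly].
have [c pqc [cl' cmin]] := first_hit p cl (poly_start q l).
have [l' [sl' ll' pl']] := simple_from sl cl'.
have [pc|pc] := pselect (p = c).
  by exists l'; subst c; split=> // z /pl'; right.
exists (c :: l'); split=> //=; first by split=> // z zpc /pl'; apply: cmin.
by move=> z [/(seg_subl pqc)|/pl']; [left|right].
Qed.

End Polygons.

Section MaxMin.
Variables (R : realType) (T : topologicalType) (f g : T -> R).
Hypotheses (cf : continuous f) (cg : continuous g).

Lemma max_continuous : continuous (fun x => Num.max (f x) (g x)).
Proof.
move=> x.
have H : {for x, continuous (f \max g)} := continuous_max (@cf x) (@cg x).
exact: H.
Qed.

End MaxMin.

Lemma min_continuous (R : realType) (T : topologicalType) (f g : T -> R) :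
  continuous f -> continuous g -> continuous (fun x => Num.min (f x) (g x)).
Proof.
move=> cf cg.
have -> : (fun x => Num.min (f x) (g x)) = (fun x => - Num.max (- f x) (- g x)).
  by apply/funext => x; rewrite oppr_max !opprK.
move=> x; apply: cvgN; apply: (@max_continuous R T (fun x => - f x) (fun x => - g x)) => y.
  by apply: cvgN; apply: cf.
by apply: cvgN; apply: cg.
Qed.

(** * Maps of the plane that collapse a segment to one of its ends *)

Section Collapse.
Variable R : realType.
Local Notation P := (R * R)%type.
Implicit Types (a c q z w : P) (K : set P).

(** With origin [c], [det] vanishes on the line of the segment and [dot] runs from 0 at [c] to [N]
    at [a]; the gauge is the largest violation of [det = 0] and [0 <= dot <= N]. Being convex and
    zero at [c], it cannot increase on the way to [c]. *)
Lemma segment_gauge a c : a <> c -> exists d : P -> R,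
  [/\ continuous d, forall z, 0 <= d z, forall z, d z = 0 <-> seg a c z
    & forall z s, 0 <= s <= 1 -> d (c + s *: (z - c)) <= d z].
Proof.
move=> ac; pose u := a - c.
pose N := u.1 * u.1 + u.2 * u.2.
pose dot z := (z - c).1 * u.1 + (z - c).2 * u.2.
pose det z := (z - c).1 * u.2 - (z - c).2 * u.1.
have N0 : 0 < N.
  have : u != 0 by rewrite subr_eq0; apply/eqP.
  rewrite /N; case: (u) => u1 u2 /= u0.
  rewrite -!expr2 lt_def addr_ge0 ?sqr_ge0 // andbT paddr_eq0 ?sqr_ge0 //.
  by rewrite !sqrf_eq0; apply: contra u0 => /andP[/eqP-> /eqP->].
have cfst : continuous (fun z => (z - c).1).
  move=> z; apply: (@continuous_comp _ _ _ (fun z : P => z - c) fst); last exact: cvg_fst.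
  by apply: cvgB; [exact: cvg_id|exact: cvg_cst].
have csnd : continuous (fun z => (z - c).2).
  move=> z; apply: (@continuous_comp _ _ _ (fun z : P => z - c) snd); last exact: cvg_snd.
  by apply: cvgB; [exact: cvg_id|exact: cvg_cst].
have cdot : continuous dot.
  by move=> z; apply: cvgD; apply: cvgM; [exact: cfst|exact: cvg_cst|exact: csnd|exact: cvg_cst].
have cdet : continuous det.
  by move=> z; apply: cvgB; apply: cvgM; [exact: cfst|exact: cvg_cst|exact: csnd|exact: cvg_cst].
have dotZ z s : dot (c + s *: (z - c)) = s * dot z.
  by rewrite /dot addBK /= /GRing.scale /=; ring.
have detZ z s : det (c + s *: (z - c)) = s * det z.
  by rewrite /det addBK /= /GRing.scale /=; ring.
exists (fun z => Num.max `|det z| (Num.max (- dot z) (dot z - N))); split.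
- apply: max_continuous => [z|].
    by apply: continuous_comp (cdet z) _; apply: norm_continuous.
  apply: max_continuous => z; first by apply: cvgN; apply: cdot.
  by apply: cvgB; [exact: cdot|exact: cvg_cst].
- by move=> z; rewrite le_max normr_ge0.
- move=> z; split=> [d0|[t /andP[t0 t1] ->]].
    have det0 : det z = 0 by apply/eqP; rewrite -normr_le0 -d0 le_max lexx.
    have dot0 : 0 <= dot z by rewrite -oppr_le0 -d0 !le_max lexx orbT.
    have dot1 : dot z <= N by rewrite -subr_le0 -d0 !le_max lexx !orbT.
    have k0 : 0 <= dot z / N by rewrite divr_ge0 // ltW.
    have k1 : dot z / N <= 1 by rewrite ler_pdivrMr // mul1r.
    have [h1 h2] : (z - c).1 = dot z / N * u.1 /\ (z - c).2 = dot z / N * u.2.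
      have e1 : (z - c).1 * N = dot z * u.1 + u.2 * det z by rewrite /det /dot /N; ring.
      have e2 : (z - c).2 * N = dot z * u.2 - u.1 * det z by rewrite /det /dot /N; ring.
      rewrite det0 mulr0 addr0 in e1; rewrite det0 mulr0 subr0 in e2.
      by split; apply: (mulIf (lt0r_neq0 N0)); rewrite mulrAC divfK ?lt0r_neq0.
    exists (1 - dot z / N); first by rewrite subr_ge0 k1 gerBl.
    move: (dot z / N) h1 h2 => k h1 h2.
    have {}h1 : z.1 - c.1 = k * (a.1 - c.1) by exact: h1.
    have {}h2 : z.2 - c.2 = k * (a.2 - c.2) by exact: h2.
    rewrite [LHS]surjective_pairing.
    by congr pair; rewrite /= /GRing.scale /=; lra.
  have -> : a + t *: (c - a) = c + (1 - t) *: (a - c).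
    by congr pair; rewrite /= /GRing.scale /=; ring.
  have -> : det (c + (1 - t) *: (a - c)) = 0 by rewrite detZ /det /u; ring.
  have -> : dot (c + (1 - t) *: (a - c)) = (1 - t) * N by rewrite dotZ /dot /u.
  apply/le_anti; rewrite le_max normr0 lexx andbT !ge_max lexx /=.
  by apply/andP; split; nra.
- move=> z s /andP[s0 s1]; rewrite dotZ detZ normrM (ger0_norm s0).
  rewrite !ge_max; apply/and3P; split.
  + by rewrite le_max ler_piMl.
  + rewrite !le_max; have [d0|d0] := leP 0 (dot z).
      by rewrite (@le_trans _ _ 0) // oppr_le0 mulr_ge0.
    by rewrite -mulrN ler_piMl ?orbT // oppr_ge0 ltW.
  + rewrite !le_max; have [d0|d0] := leP 0 (dot z).
      by rewrite lerD2r ler_piMl ?orbT.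
    apply/orP; left; apply: le_trans (normr_ge0 _); rewrite subr_le0.
    by apply: le_trans (ltW N0); rewrite mulr_ge0_le0 // ltW.
Qed.

(* [z |-> c + m z *: (z - c)] contracts the segment to [c], is injective
   elsewhere, and fixes [K]. *)
Lemma collapsing_factor a c K : a <> c -> compact K ->
  (forall z, K z -> ~ seg a c z) -> exists m : P -> R,
  [/\ continuous m, forall z, 0 <= m z <= 1, forall z, m z = 0 <-> seg a c z,
      forall z s, 0 <= s <= 1 -> m (c + s *: (z - c)) <= m z
    & forall z, K z -> m z = 1].
Proof.
move=> ac cK Kac; have [d [cd d0 dz dm]] := segment_gauge ac.
have [e e0 Ke] : exists2 e, 0 < e & forall z, K z -> e <= d z.
  have [[z0 Kz0]|noK] := pselect (K !=set0); last first.
    by exists 1 => // z Kz; case: noK; exists z.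
  have [||z Kz zmin] := compact_EVT_min (f := d) _ cK; first by exists z0.
    exact: continuous_subspaceT.
  exists (d z); last by move=> w Kw; apply: zmin; rewrite inE.
  rewrite lt_def d0 andbT; apply/eqP => /dz; apply: Kac.
  by rewrite inE in Kz.
exists (fun z => Num.min 1 (d z / e)); split.
- apply: min_continuous => z; first exact: cvg_cst.
  by apply: cvgM; [exact: cd|exact: cvg_cst].
- by move=> z; rewrite le_min ler01 ge_min lexx divr_ge0 // ltW.
- move=> z; rewrite -dz; split=> [|->]; last by rewrite mul0r min_r.
  case: leP => _ => [/eqP|/eqP]; first by rewrite oner_eq0.
  by rewrite mulf_eq0 invr_eq0 (gt_eqF e0) orbF => /eqP.
- move=> z s s01; rewrite le_min !ge_min lexx /=; apply/orP; right.
  by rewrite ler_pM2r ?invr_gt0 // dm.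
- by move=> z /Ke ez; rewrite min_l // ler_pdivlMr // mul1r.
Qed.

Section Factor.
Variables (a c : P) (m : P -> R).
Hypotheses (cm : continuous m) (m01 : forall z, 0 <= m z <= 1)
  (mz : forall z, m z = 0 <-> seg a c z)
  (mm : forall z s, 0 <= s <= 1 -> m (c + s *: (z - c)) <= m z).

Definition collapse z := c + m z *: (z - c).

Lemma collapse_continuous : continuous collapse.
Proof.
move=> z; apply: cvgD; first exact: cvg_cst.
apply: cvgZ; first exact: cm.
by apply: cvgB; [exact: cvg_id|exact: cvg_cst].
Qed.

Lemma collapse_seg z : seg a c z -> collapse z = c.
Proof. by move=> /mz mz0; rewrite /collapse mz0 scale0r addr0. Qed.

(** Rays from [c] are preserved, and along a ray [m] does not decrease away from [c]; where [m] is
    positive, the new distance to [c] is thus strictly increasing in the old one. *)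
Lemma collapse_inj z w : ~ seg a c z -> collapse z = collapse w -> z = w.
Proof.
wlog : z w / m w <= m z => [wl nz e|].
  have [le|/ltW le] := leP (m w) (m z); first exact: wl.
  apply/esym/wl => // /mz mw0; move: le; rewrite mw0.
  have /andP[mz0 _] := m01 z => mz1; apply: nz; apply/mz/le_anti.
  by rewrite mz0 mz1.
move=> mwz nz /addrI e.
have mz0 : 0 < m z.
  by have /andP[m0 _] := m01 z; rewrite lt_def m0 andbT; apply/eqP => /mz.
have zE : z = c + (m w / m z) *: (w - c).
  by rewrite mulrC -scalerA -e scalerA mulVf ?gt_eqF // scale1r addrC subrK.
have s01 : 0 <= m w / m z <= 1.
  have /andP[w0 _] := m01 w.
  by rewrite (divr_ge0 w0 (ltW mz0)) /= ler_pdivrMr // mul1r.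
have := mm w s01; rewrite -zE => mzw.
have mE : m w = m z by apply/le_anti; rewrite mwz mzw.
by rewrite zE mE divff ?gt_eqF // scale1r addrC subrK.
Qed.

(** The image of [z] lies between [c] and [z], so [m] is at least as large at [z] as at its
    image. *)
Lemma collapse_fixed z : m (collapse z) = 1 -> collapse z = z.
Proof.
move=> m1; suff mz1 : m z = 1 by rewrite /collapse mz1 scale1r addrC subrK.
apply/le_anti; have /andP[_ ->] := m01 z.
by rewrite -m1; apply: mm.
Qed.

End Factor.

End Collapse.

(** * Drawings, polygonal drawings, contraction *)

Section Drawings.
Variables (R : realType) (V E : Type) (e1 e2 : E -> V).
Local Notation P := (R * R)%type.

(* The drawings of [plane_drawing], with arcs extended continuously to the whole
   line, and without requiring the vertices to have distinct positions. *)
Record draws (pos : V -> P) (arc : E -> R -> P) : Prop := Draws {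
  draws_cts : forall e, continuous (arc e);
  draws_0 : forall e, arc e 0 = pos (e1 e);
  draws_1 : forall e, arc e 1 = pos (e2 e);
  draws_inj : forall e s t, 0 < s < 1 -> 0 < t < 1 -> arc e s = arc e t -> s = t;
  draws_pos : forall e v t, 0 < t < 1 -> arc e t <> pos v;
  draws_arc : forall e f s t, e <> f -> 0 < s < 1 -> 0 < t < 1 -> arc e s <> arc f t
}.

(** Interior points of arcs avoid the segment, and injectivity off the segment separates their
    images from all others. Only vertices can be identified, which [draws] permits. *)
Lemma draws_collapse pos arc (a c : P) (m : P -> R) : draws pos arc ->
  continuous m -> (forall z, 0 <= m z <= 1) -> (forall z, m z = 0 <-> seg a c z) ->
  (forall z s, 0 <= s <= 1 -> m (c + s *: (z - c)) <= m z) ->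
  (forall e t, 0 < t < 1 -> ~ seg a c (arc e t)) ->
  draws (collapse c m \o pos) (fun e => collapse c m \o arc e).
Proof.
move=> D cm m01 mz mm sarc.
have inj e t z : 0 < t < 1 -> collapse c m (arc e t) = collapse c m z -> arc e t = z.
  by move=> t01; apply: (collapse_inj m01 mz mm); apply: sarc.
split=> /=.
- move=> e t; apply: continuous_comp; first exact: (draws_cts D).
  exact: collapse_continuous.
- by move=> e; rewrite (draws_0 D).
- by move=> e; rewrite (draws_1 D).
- by move=> e s t s01 t01 /(inj _ _ _ s01); apply: (draws_inj D).
- by move=> e v t t01 /(inj _ _ _ t01); apply: (draws_pos D).
- by move=> e f s t ef s01 t01 /(inj _ _ _ s01); apply: (draws_arc D).
Qed.

(** Each step collapses the first segment to its far end [q]: [pos v] moves to [q], and one segment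
    fewer separates it from [pos u]. The last collapse makes the two vertices meet. *)
Lemma contract_polygon pos arc (v u : V) (l : seq P) : draws pos arc ->
  injective pos -> v <> u -> simple (pos v) l -> last (pos v) l = pos u ->
  (forall e t, 0 < t < 1 -> ~ poly (pos v) l (arc e t)) ->
  (forall w, poly (pos v) l (pos w) -> w = v \/ w = u) ->
  exists pos' arc', [/\ draws pos' arc', pos' v = pos' u &
    forall x y, pos' x = pos' y -> x = y \/ (x = v \/ x = u) /\ (y = v \/ y = u)].
Proof.
elim: l pos arc => [|q l IH] pos arc D ipos vu /=.
  by move=> _ /ipos /vu.
move=> [vq qseg sl] el parc ppos.
(* [K] omits the second segment: it starts at the centre [q], near which [m] is small, so its points
   do move, though only along their ray. *)
pose K : set P := if l is q2 :: l2 then poly q2 l2 else set0.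
have cK : compact K.
  by rewrite /K; case: (l) => [|q2 l2]; [exact: compact0|exact: compact_poly].
have Kp z : K z -> poly q l z by rewrite /K; case: (l) => // q2 l2; right.
have nKq : ~ K q.
  rewrite /K; case: (l) sl => [_ []|q2 l2 [qq2 sq _]] Kq; apply: qq2.
  exact: (sq _ (seg_start _ _) Kq).
have Kseg z : K z -> ~ seg (pos v) q z.
  by move=> Kz sz; apply: nKq; rewrite -(qseg _ sz (Kp _ Kz)).
have [m [cm m01 mz mm Km]] := collapsing_factor vq cK Kseg.
set phi := collapse q m.
have sarc e t : 0 < t < 1 -> ~ seg (pos v) q (arc e t).
  by move=> t01 s; apply: (parc e t t01); left.
have D' := draws_collapse D cm m01 mz mm sarc.
have inj z w : ~ seg (pos v) q z -> phi z = phi w -> z = w.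
  exact: (collapse_inj m01 mz mm).
have phiv : phi (pos v) = q by apply: (collapse_seg mz); apply: seg_start.
have posseg w : seg (pos v) q (pos w) -> w = v \/ w = u.
  by move=> s; apply: ppos; left.
case: l @K cK Kp nKq Kseg Km sl el parc ppos qseg IH => [|q2 l2] K cK Kp nKq Kseg Km sl el parc ppos qseg IH.
  exists (phi \o pos), (fun e => phi \o arc e); split=> //=.
    rewrite phiv; apply/esym/(collapse_seg mz).
    by rewrite -el /=; apply: seg_end.
  move=> x y xy; have [sx|sx] := pselect (seg (pos v) q (pos x)); last first.
    by left; apply: ipos; apply: inj xy.
  have [sy|sy] := pselect (seg (pos v) q (pos y)); last first.
    by left; apply/esym/ipos; apply: inj (esym xy).
  by right; split; apply: posseg.
have [qq2 sq sl2] := sl.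
have Ku : K (pos u) by rewrite -el; apply: poly_end.
have fixK z : K z -> phi z = z by move=> Kz; rewrite /phi /collapse Km // scale1r addrC subrK.
(* A point sent into the segment from [q] to [q2] comes from the same ray. It cannot come from
   beyond [q2]: there [m] is at least [m q2 = 1], and the point would be fixed. *)
have away z : ~ poly (pos v) (q :: q2 :: l2) z -> ~ poly q (q2 :: l2) (phi z).
  move=> nz [[s /andP[s0 s1] zE]|Kz]; last first.
    have e := collapse_fixed m01 mm (Km _ Kz); apply: nz; right; right.
    by rewrite -e.
  have mz0 : 0 < m z.
    have /andP[m0 _] := m01 z; rewrite lt_def m0 andbT; apply/eqP => /mz sz.
    by apply: nz; left.
  have zE' : m z *: (z - q) = s *: (q2 - q) by move: zE; rewrite /phi /collapse => /addrI.
  have [sm|sm] := leP s (m z).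
    apply: nz; right; left; exists (s / m z).
      by rewrite (divr_ge0 s0 (ltW mz0)) /= ler_pdivrMr // mul1r.
    by rewrite mulrC -scalerA -zE' scalerA mulVf ?gt_eqF // scale1r addrC subrK.
  have s0' : 0 < s by apply: lt_trans sm.
  have q2E : q2 = q + (m z / s) *: (z - q).
    by rewrite mulrC -scalerA zE' scalerA mulVf ?gt_eqF // scale1r addrC subrK.
  have ms01 : 0 <= m z / s <= 1.
    by rewrite (divr_ge0 (ltW mz0) s0) /= ler_pdivrMr // mul1r ltW.
  have := mm z _ ms01; rewrite -q2E Km; last exact: poly_start.
  by move=> m1; have := lt_le_trans sm s1; rewrite ltNge m1.
have pinj : injective (phi \o pos).
  move=> x y /= xy; have [sx|sx] := pselect (seg (pos v) q (pos x)); last first.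
    by apply: ipos; apply: inj xy.
  have [sy|sy] := pselect (seg (pos v) q (pos y)); last first.
    by apply/esym/ipos; apply: inj (esym xy).
  have eqv w : seg (pos v) q (pos w) -> w = v.
    by move=> sw; case: (posseg _ sw) => // wu; case: (Kseg _ Ku); rewrite -wu.
  by rewrite (eqv _ sx) (eqv _ sy).
apply: (IH (phi \o pos) _ D') => //=; rewrite ?phiv //.
- by rewrite -/(last q2 l2); rewrite fixK //; apply: el.
- by move=> e t t01; apply: away; apply: parc.
- move=> w pw; apply: contrapT => nw; apply: (away (pos w)) pw.
  by move=> pw; apply: nw; apply: ppos.
Qed.

End Drawings.

Lemma planar_draws (R : realType) (G : mgraph) : planar R G <->
  exists pos arc, injective pos /\ draws (@end1 G) (@end2 G) pos (arc : _ -> R -> R * R).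
Proof.
split=> [[pos [arc [ipos harc hpos hdis]]]|[pos [arc [ipos D]]]]; last first.
  exists pos, arc; split=> //.
  - move=> e; split; [|exact: (draws_0 D)|exact: (draws_1 D)|].
      exact/continuous_subspaceT/(draws_cts D).
    by move=> s t; rewrite !in_itv /=; apply: (draws_inj D).
  - by move=> e v t; rewrite in_itv /=; apply: (draws_pos D).
  - by move=> e f /eqP ef s t; rewrite !in_itv /=; apply: (draws_arc D).
(* Arcs are extended by constants outside [0, 1]. *)
pose clamp (t : R) := Num.max 0 (Num.min 1 t).
have clampE t : 0 <= t <= 1 -> clamp t = t.
  by move=> /andP[t0 t1]; rewrite /clamp min_r // max_r.
have clampE' t : 0 < t < 1 -> clamp t = t by move=> /andP[/ltW ? /ltW ?]; rewrite clampE // ; apply/andP.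
have clamp01 t : 0 <= clamp t <= 1 by rewrite /clamp le_max lexx ge_max ler01 ge_min lexx.
have cc : continuous clamp.
  apply: max_continuous => t; first exact: cvg_cst.
  by apply: min_continuous => {}t; [exact: cvg_cst|exact: cvg_id].
exists pos, (fun e t => arc e (clamp t)); split=> //; split.
- move=> e t; have [/subspace_continuousP carc _ _ _] := harc e.
  have /carc ct : `[0, 1]%classic (clamp t) by rewrite /= in_itv /=.
  move=> U nU; have near_t : nbhs (clamp t) (fun y => `[0, 1]%classic y -> U (arc e y)) := ct U nU.
  have ncl := cc t _ near_t; apply: (@filterS _ (nbhs t) _ _ _ _ ncl) => s; apply.
  by rewrite /= in_itv /=.
- by move=> e; rewrite clampE ?lexx ?ler01 //; have [] := harc e.
- by move=> e; rewrite clampE ?lexx ?ler01 //; have [] := harc e.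
- move=> e s t s01 t01; rewrite !clampE' //; have [_ _ _ inj] := harc e.
  by apply: inj; rewrite in_itv.
- by move=> e v t t01; rewrite clampE' //; apply: hpos; rewrite in_itv.
- by move=> e f s t /eqP ef s01 t01; rewrite !clampE' //; apply: (hdis e f ef); rewrite in_itv.
Qed.

(** * Straightening the arcs near the vertices *)

Section Exit.
Variables (R : realType) (f : R -> R).
Hypothesis cf : continuous f.

Lemma last_exit (x y r : R) : x <= y -> f x <= r < f y ->
  exists2 a, x <= a <= y & f a = r /\ forall s, a < s <= y -> r < f s.
Proof.
move=> xy /andP[fx fy].
pose A := `[x, y]%classic `&` f @^-1` [set t | t <= r].
have cA : compact A.
  apply: compact_closedI; first exact: segment_compact.
  by apply: closed_comp; [move=> t _; exact: cf|exact: closed_le].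
have A0 : A !=set0 by exists x; split=> //=; rewrite in_itv /= lexx.
have [|a] := compact_EVT_max A0 cA (f := id).
  by apply: continuous_subspaceT => ?; exact: cvg_id.
rewrite inE => -[/=]; rewrite in_itv /= => /andP[xa ay] far amax.
have above s : a < s <= y -> r < f s.
  move=> /andP[as_ sy]; rewrite ltNge; apply/negP => fs.
  have : s <= a.
    by apply: amax; rewrite inE; split=> //=; rewrite in_itv /= sy (le_trans xa) // ltW.
  by rewrite leNgt as_.
exists a; first by rewrite xa ay.
split=> //; have [||c] := @IVT R f a y r ay; first exact: continuous_subspaceT.
  by rewrite ge_min far le_max (ltW fy) orbT.
rewrite in_itv /= => /andP[ac cy] fc.
move: ac; rewrite le_eqVlt => /predU1P[-> //|ac].
by have := above c; rewrite fc ac cy ltxx => /(_ isT).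
Qed.

End Exit.

Lemma first_entry (R : realType) (f : R -> R) (x y r : R) : continuous f ->
  x <= y -> f y <= r < f x ->
  exists2 b, x <= b <= y & f b = r /\ forall s, x <= s < b -> r < f s.
Proof.
move=> cf xy fr; have cg : continuous (fun s => f (- s)).
  by move=> s; apply: continuous_comp; [exact: opp_continuous|exact: cf].
have [||b /andP[yb bx] [fb bs]] := last_exit cg (x := - y) (y := - x) (r := r).
- by rewrite lerN2.
- by rewrite !opprK.
exists (- b); first by rewrite lerNr bx lerNl.
split=> // s /andP[xs sb]; rewrite -[s]opprK; apply: bs.
by rewrite ltrNr sb lerN2.
Qed.

Lemma uniform_radius (R : realDomainType) (I : finType) (Q : I -> R -> Prop) :
  (forall i r r', 0 < r' <= r -> Q i r -> Q i r') ->
  (forall i, exists2 r, 0 < r & Q i r) -> exists2 r, 0 < r & forall i, Q i r.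
Proof.
move=> mono ex.
suff [r r0 Qr] : exists2 r, 0 < r & forall i, i \in enum I -> Q i r.
  by exists r => // i; apply: Qr; rewrite mem_enum.
elim: (enum I) => [|i s [r r0 Qr]]; first by exists 1.
have [r' r'0 Qr'] := ex i; exists (Num.min r r'); first by rewrite lt_min r0.
move=> j; rewrite in_cons => /predU1P[->|js].
  by apply: mono Qr'; rewrite lt_min r0 r'0 ge_min lexx orbT.
by apply: mono (Qr _ js); rewrite lt_min r0 r'0 ge_min lexx.
Qed.

Section Radial.
Variable R : realType.
Local Notation P := (R * R)%type.

Lemma dist_continuous (g : R -> P) (p : P) : continuous g -> continuous (fun t => `|g t - p|).
Proof.
move=> cg t; apply: (@continuous_comp _ _ _ (fun t => g t - p) Num.norm).
  by apply: cvgB; [exact: cg|exact: cvg_cst].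
exact: norm_continuous.
Qed.

Lemma arc_away (g : R -> P) (p : P) : continuous g ->
  (forall t, 0 <= t <= 1 -> g t <> p) ->
  exists2 r, 0 < r & forall t, 0 <= t <= 1 -> r <= `|g t - p|.
Proof.
move=> cg gp; have [||c] := @EVT_min R (fun t => `|g t - p|) 0 1; first exact: ler01.
  exact/continuous_subspaceT/dist_continuous.
rewrite in_itv /= => c01 cmin; exists `|g c - p|.
  by rewrite normr_gt0 subr_eq0; apply/eqP; apply: gp.
by move=> t t01; apply: cmin; rewrite in_itv.
Qed.

Lemma arcs_away (g h : R -> P) (a b : R) : continuous g -> continuous h -> a <= b ->
  (forall s t, a <= s <= b -> 0 <= t <= 1 -> g s <> h t) ->
  exists2 r, 0 < r & forall s t, a <= s <= b -> 0 <= t <= 1 -> r <= `|g s - h t|.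
Proof.
move=> cg ch ab gh.
have cK : compact (`[a, b]%classic `*` `[0, 1]%classic : set (R * R)).
  by apply: compact_setX; apply: segment_compact.
have K0 : (`[a, b]%classic `*` `[0, 1]%classic : set (R * R)) !=set0.
  by exists (a, 0); split; rewrite /= in_itv /= lexx ?ab ?ler01.
have [|c] := compact_EVT_min (f := fun z : R * R => `|g z.1 - h z.2|) K0 cK.
  apply: continuous_subspaceT => z.
  apply: (@continuous_comp _ _ _ (fun z : R * R => g z.1 - h z.2) Num.norm).
    by apply: cvgB; [apply: (continuous_comp cvg_fst)|apply: (continuous_comp cvg_snd)];
      [exact: cg|exact: ch].
  exact: norm_continuous.
rewrite inE => -[/=]; rewrite !in_itv /= => c1 c2 cmin; exists `|g c.1 - h c.2|.
  by rewrite normr_gt0 subr_eq0; apply/eqP; apply: gh.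
by move=> s t sab t01; apply: (cmin (s, t)); rewrite inE; split; rewrite /= in_itv.
Qed.

(* Replaces [g] by segments on [0, a] and [b, 1]; written with [min] and [max]
   rather than by cases to make its continuity immediate. *)
Definition straighten (g : R -> P) (a b : R) (s : R) : P :=
  g (Num.max a (Num.min b s)) + (Num.min 1 (s / a) - 1) *: (g a - g 0)
  + (Num.min 1 ((1 - s) / (1 - b)) - 1) *: (g b - g 1).

Section Straighten.
Variables (g : R -> P) (a b : R).
Hypotheses (cg : continuous g) (a0 : 0 < a) (ab : a < b) (b1 : b < 1).

Lemma straighten_continuous : continuous (straighten g a b).
Proof.
have cmin (h : R -> R) : continuous h -> continuous (fun s => Num.min 1 (h s) - 1).
  move=> ch s; apply: cvgB; last exact: cvg_cst.
  by apply: min_continuous => {}s; [exact: cvg_cst|exact: ch].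
move=> s; apply: cvgD; first apply: cvgD.
- apply: continuous_comp; last exact: cg.
  apply: max_continuous => {}s; first exact: cvg_cst.
  by apply: min_continuous => {}s; [exact: cvg_cst|exact: cvg_id].
- apply: cvgZr_tmp; apply: (cmin (fun s => s / a)) => {}s.
  by apply: cvgM; [exact: cvg_id|exact: cvg_cst].
- apply: cvgZr_tmp; apply: (cmin (fun s => (1 - s) / (1 - b))) => {}s.
  by apply: cvgM; [apply: cvgB; [exact: cvg_cst|exact: cvg_id]|exact: cvg_cst].
Qed.

Let b0 : 0 < 1 - b. Proof. by rewrite subr_gt0. Qed.

Lemma straighten_start s : s <= a -> straighten g a b s = g 0 + (s / a) *: (g a - g 0).
Proof.
move=> sa; have sb : s < b by apply: le_lt_trans ab.
rewrite /straighten min_r ?ltW // max_l // min_r ?ler_pdivrMr ?mul1r //.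
rewrite min_l ?ler_pdivlMr ?mul1r ?lerD2l ?lerN2 ?ltW // subrr scale0r addr0.
by rewrite scalerBl scale1r opprB addrCA [X in _ + X]addrC subrK addrC.
Qed.

Lemma straighten_mid s : a <= s <= b -> straighten g a b s = g s.
Proof.
move=> /andP[sa sb].
rewrite /straighten min_r // max_r // min_l ?ler_pdivlMr ?mul1r //.
by rewrite min_l ?ler_pdivlMr ?mul1r ?lerD2l ?lerN2 // subrr !scale0r !addr0.
Qed.

Lemma straighten_end s : b <= s ->
  straighten g a b s = g 1 + ((1 - s) / (1 - b)) *: (g b - g 1).
Proof.
move=> sb; have sa : a < s by apply: lt_le_trans sb.
rewrite /straighten min_l // max_r ?ltW // min_l ?ler_pdivlMr ?mul1r ?ltW //.
rewrite min_r ?ler_pdivrMr ?mul1r ?lerD2l ?lerN2 // subrr scale0r addr0.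
by rewrite scalerBl scale1r opprB addrCA [X in _ + X]addrC subrK addrC.
Qed.

End Straighten.

(** [a] is the last time at distance [r] from [g 0], and [b] the first time after [a] at distance
    [r] from [g 1]; this order keeps the part in between out of both balls. *)
Lemma radial_times (g : R -> P) (r : R) : continuous g -> 0 < r ->
  2 * r < `|g 0 - g 1| -> exists a b,
  [/\ 0 < a, a < b, b < 1, `|g a - g 0| = r /\ `|g b - g 1| = r &
    forall s, a <= s <= b -> r <= `|g s - g 0| /\ r <= `|g s - g 1|].
Proof.
move=> cg r0 r01.
have [||a /andP[a0 a1] [ga aout]] := last_exit (@dist_continuous g (g 0) cg) (x := 0) (y := 1) (r := r).
- exact: ler01.
- by rewrite subrr normr0 ltW //= distrC; lra.
have {}a0 : 0 < a.
  by rewrite lt_def a0 andbT; apply: contraTneq r0 => aE; rewrite -ga aE subrr normr0 ltxx.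
have gar : r < `|g a - g 1|.
  have := ler_distD (g a) (g 0) (g 1); rewrite [X in _ <= X + _]distrC ga; lra.
have [||b /andP[ab b1] [gb bout]] := first_entry (@dist_continuous g (g 1) cg) (x := a) (y := 1) (r := r).
- by [].
- by rewrite subrr normr0 ltW.
have {}ab : a < b by rewrite lt_def ab andbT; apply: contraTneq gar => <-; rewrite gb ltxx.
have {}b1 : b < 1.
  by rewrite lt_def b1 andbT; apply: contraTneq r0 => bE; rewrite -gb -bE subrr normr0 ltxx.
exists a, b; split=> // s /andP[as_ sb]; split.
  move: as_; rewrite le_eqVlt => /predU1P[<-|as_]; first by rewrite ga.
  by apply/ltW/aout; rewrite as_ (le_trans sb) // ltW.
move: sb; rewrite le_eqVlt => /predU1P[->|sb]; first by rewrite gb.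
by apply/ltW/bout; rewrite as_.
Qed.

End Radial.

Section RadialDrawing.
Variables (R : realType) (V E : finType) (e1 e2 : E -> V).
Local Notation P := (R * R)%type.
Variables (pos : V -> P) (arc : E -> R -> P).
Hypotheses (loopfree : forall e, e1 e <> e2 e) (ipos : injective pos)
  (D : draws e1 e2 pos arc).

Lemma separating_radius : exists2 r, 0 < r &
  (forall v w, v <> w -> 2 * r < `|pos v - pos w|) /\
  (forall e w t, w <> e1 e -> w <> e2 e -> 0 <= t <= 1 -> r <= `|arc e t - pos w|).
Proof.
have [r1 r10 Q1] : exists2 r, 0 < r & forall vw : V * V,
    vw.1 <> vw.2 -> 2 * r < `|pos vw.1 - pos vw.2|.
  apply: uniform_radius => [vw r r' /andP[_ r'r] H /H|[v w]] /=; first lra.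
  have [->|vw] := eqVneq v w; first by exists 1.
  have p0 : 0 < `|pos v - pos w|.
    by rewrite normr_gt0 subr_eq0; apply: contraNneq vw => /ipos ->.
  exists (`|pos v - pos w| / 4); first by rewrite divr_gt0.
  by move=> _; lra.
have [r2 r20 Q2] : exists2 r, 0 < r & forall ew : E * V,
    ew.2 <> e1 ew.1 -> ew.2 <> e2 ew.1 -> forall t, 0 <= t <= 1 ->
    r <= `|arc ew.1 t - pos ew.2|.
  apply: uniform_radius => [ew r r' /andP[_ r'r] H w1 w2 t t01|[e w]] /=.
    exact: le_trans r'r (H w1 w2 t t01).
  have [w1|w1] := pselect (w = e1 e); first by exists 1.
  have [w2|w2] := pselect (w = e2 e); first by exists 1.
  have [|r r0 Hr] := @arc_away R (arc e) (pos w) (draws_cts D (e := e)); last by exists r.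
  move=> t /andP[]; rewrite !le_eqVlt => /predU1P[<- _|t0 /predU1P[->|t1]].
  - by rewrite (draws_0 D) => /ipos /esym.
  - by rewrite (draws_1 D) => /ipos /esym.
  - by apply: (draws_pos D); rewrite t0.
exists (Num.min r1 r2); first by rewrite lt_min r10.
split=> [v w vw|e w t w1 w2 t01].
  apply: le_lt_trans (Q1 (v, w) vw); rewrite ler_pM2l //.
  by rewrite ge_min lexx.
by apply: le_trans (Q2 (e, w) w1 w2 t t01); rewrite ge_min lexx orbT.
Qed.

(** Around each vertex the arcs become radii of one ball. Radii meet only at the centre because
    their outer ends are distinct points of the old drawing at the same distance [r]; the middle
    parts stay at distance at least [r] from every vertex and so miss the radii. *)
Lemma radial_drawing : exists arc' (a b : E -> R) r,
  [/\ 0 < r, draws e1 e2 pos arc',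
    forall e, [/\ 0 < a e, a e < b e & b e < 1],
    forall e, (forall s, s <= a e -> arc' e s = pos (e1 e) + (s / a e) *: (arc' e (a e) - pos (e1 e))) /\
      (forall s, b e <= s -> arc' e s =
         pos (e2 e) + ((1 - s) / (1 - b e)) *: (arc' e (b e) - pos (e2 e)))
  & forall e s w, a e <= s <= b e -> r <= `|arc' e s - pos w|].
Proof.
have [r r0 [rV rE]] := separating_radius.
have /choice[ab abP] : forall e, exists ab : R * R,
  [/\ 0 < ab.1, ab.1 < ab.2, ab.2 < 1,
      `|arc e ab.1 - pos (e1 e)| = r /\ `|arc e ab.2 - pos (e2 e)| = r &
      forall s, ab.1 <= s <= ab.2 ->
        r <= `|arc e s - pos (e1 e)| /\ r <= `|arc e s - pos (e2 e)|].
  move=> e; have [|a [b H]] := @radial_times R (arc e) r (draws_cts D (e := e)) r0.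
    by rewrite (draws_0 D) (draws_1 D); apply: rV.
  by exists (a, b); move: H; rewrite (draws_0 D) (draws_1 D).
pose a e := (ab e).1; pose b e := (ab e).2.
have a0 e : 0 < a e by case: (abP e).
have aLb e : a e < b e by case: (abP e).
have b1 e : b e < 1 by case: (abP e).
have ar e : `|arc e (a e) - pos (e1 e)| = r by case: (abP e) => _ _ _ [].
have br e : `|arc e (b e) - pos (e2 e)| = r by case: (abP e) => _ _ _ [].
have mid e s w : a e <= s <= b e -> r <= `|arc e s - pos w|.
  move=> sab; have [_ _ _ _ /(_ s sab)[m1 m2]] := abP e.
  have [->//|w1] := pselect (w = e1 e); have [->//|w2] := pselect (w = e2 e).
  apply: rE => //; move/andP: sab => [sa sb].
  by rewrite (le_trans (ltW (a0 e)) sa) (le_trans sb (ltW (b1 e))).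
pose arc' e := straighten (arc e) (a e) (b e).
have Z1 e s : s <= a e -> arc' e s = pos (e1 e) + (s / a e) *: (arc e (a e) - pos (e1 e)).
  by move=> sa; rewrite /arc' straighten_start // (draws_0 D).
have Z2 e s : a e <= s <= b e -> arc' e s = arc e s.
  by move=> sab; rewrite /arc' straighten_mid.
have Z3 e s : b e <= s ->
    arc' e s = pos (e2 e) + ((1 - s) / (1 - b e)) *: (arc e (b e) - pos (e2 e)).
  by move=> sa; rewrite /arc' straighten_end // (draws_1 D).
have a01 e : 0 < a e < 1 by rewrite a0 (lt_trans (aLb e)).
have b01 e : 0 < b e < 1 by rewrite b1 (lt_trans (a0 e)).
(* The point lies at the fraction [k] of the radius from [pos w] to [arc e c]; the last clause
   serves to recover [s] from [k]. *)
pose radial e s w c k := [/\ 0 < k < 1, 0 < c < 1, `|arc e c - pos w| = r,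
  arc' e s = pos w + k *: (arc e c - pos w) &
  [/\ w = e1 e, c = a e & k = s / a e] \/ [/\ w = e2 e, c = b e & k = (1 - s) / (1 - b e)]].
have desc e s : 0 < s < 1 -> (a e <= s <= b e /\ arc' e s = arc e s) \/
    exists w c k, radial e s w c k.
  move=> /andP[s0 s1].
  have [sa|sa] := ltP s (a e).
    right; exists (e1 e), (a e), (s / a e); split; rewrite ?Z1 ?ltW //; last by left.
    by rewrite divr_gt0 //= ltr_pdivrMr // mul1r.
  have [sb|sb] := ltP (b e) s; last by left; split; rewrite ?Z2 ?sa ?sb.
  right; exists (e2 e), (b e), ((1 - s) / (1 - b e)); split; rewrite ?Z3 ?ltW //; last by right.
  by rewrite divr_gt0 ?subr_gt0 //= ltr_pdivrMr ?subr_gt0 // mul1r ltrD2l ltrN2.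
have rdist e s w c k : radial e s w c k -> `|arc' e s - pos w| = k * r.
  move=> [/andP[k0 _] _ cr -> _].
  by rewrite addBK normrZ cr ger0_norm // ltW.
have near e s w c k w' : radial e s w c k -> `|arc' e s - pos w'| < r -> w' = w.
  move=> Rd; have [/andP[k0 k1] _ _ _ _] := Rd; have d := rdist _ _ _ _ _ Rd => lt.
  apply: contrapT => ww'; have := rV _ _ ww'.
  have := ler_distD (arc' e s) (pos w') (pos w); rewrite d [X in _ <= X + _]distrC.
  have : k * r < r by rewrite gtr_pMl.
  lra.
have rlt e s w c k : radial e s w c k -> `|arc' e s - pos w| < r.
  move=> Rd; rewrite (rdist _ _ _ _ _ Rd); have [/andP[_ k1] _ _ _ _] := Rd.
  by rewrite gtr_pMl.
have same e f s t : 0 < s < 1 -> 0 < t < 1 -> arc' e s = arc' f t -> e = f /\ s = t.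
  move=> s01 t01 est.
  have [[sab eE]|[w [c [k Rd]]]] := desc e s s01;
    have [[tab fE]|[w' [c' [k' Rd']]]] := desc f t t01.
  - have ef : e = f.
      by apply: contrapT => ef; apply: (draws_arc D ef s01 t01); rewrite -eE -fE.
    by split=> //; subst f; apply: (draws_inj D (e := e)) => //; rewrite -eE -fE.
  - by have := rlt _ _ _ _ _ Rd'; rewrite -est eE ltNge mid.
  - by have := rlt _ _ _ _ _ Rd; rewrite est fE ltNge mid.
  have ww : w' = w by apply: near Rd _; rewrite est; apply: rlt Rd'.
  subst w'; have kk : k = k'.
    apply: (mulIf (lt0r_neq0 r0)).
    by rewrite -(rdist _ _ _ _ _ Rd) -(rdist _ _ _ _ _ Rd') est.
  subst k'; have [/andP[k0 k1] c01 _ Ae Te] := Rd; have [_ c01' _ Af Tf] := Rd'.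
  have cc : arc e c = arc f c'.
    apply: (addIr (- pos w)); apply: (scalerI (lt0r_neq0 k0)); apply: (addrI (pos w)).
    by rewrite -Ae -Af.
  have ef : e = f.
    by apply: contrapT => ef; apply: (draws_arc D ef c01 c01').
  subst f; have {}cc := draws_inj D c01 c01' cc; subst c'; split=> //.
  case: Te => [[_ cE kE]|[_ cE kE]]; case: Tf => [[_ cE' kE']|[_ cE' kE']].
  - by apply: (mulIf (invr_neq0 (lt0r_neq0 (a0 e)))); rewrite -kE -kE'.
  - by have := aLb e; rewrite -cE -cE' ltxx.
  - by have := aLb e; rewrite -cE -cE' ltxx.
  - have b0' : 0 < 1 - b e by rewrite subr_gt0.
    apply: oppr_inj; apply: (addrI 1); apply: (mulIf (invr_neq0 (lt0r_neq0 b0'))).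
    by rewrite -kE -kE'.
exists arc', a, b, r; split=> //.
- split.
  + by move=> e; apply: straighten_continuous; exact: (draws_cts D).
  + by move=> e; rewrite Z1 ?ltW // mul0r scale0r addr0.
  + by move=> e; rewrite Z3 ?ltW // subrr mul0r scale0r addr0.
  + by move=> e s t s01 t01 /(same _ _ _ _ s01 t01)[].
  + move=> e v s s01 sv.
    have [[sab eE]|[w [c [k Rd]]]] := desc e s s01.
      by have := mid e s v sab; rewrite -eE sv subrr normr0 leNgt r0.
    have vw : v = w by apply: near Rd _; rewrite sv subrr normr0.
    have := rdist _ _ _ _ _ Rd; rewrite sv vw subrr normr0.
    by have [/andP[k0 _] _ _ _ _] := Rd => /esym/eqP; rewrite gt_eqF // mulr_gt0.
  + by move=> e f s t ef s01 t01 /(same _ _ _ _ s01 t01)[].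
- move=> e; rewrite [arc' e (a e)]Z2 ?lexx ?ltW // [arc' e (b e)]Z2 ?lexx ?ltW //.
  by split=> s sa; [apply: Z1|apply: Z3].
- by move=> e s w sab; rewrite Z2 //; apply: mid.
Qed.

End RadialDrawing.

(** * Simple polygons in tubes around the arcs *)

Section Polygonal.
Variable R : realType.
Local Notation P := (R * R)%type.

Definition tube (g : R -> P) (a b eps : R) : set P :=
  [set z | exists2 s, a <= s <= b & `|z - g s| < eps].

Lemma seg_near (p q c z : P) (eps : R) :
  `|p - c| < eps -> `|q - c| < eps -> seg p q z -> `|z - c| < eps.
Proof.
move=> pc qc [t /andP[t0 t1] ->].
have -> : p + t *: (q - p) - c = (1 - t) *: (p - c) + t *: (q - c).
  by congr pair; rewrite /= /GRing.scale /=; ring.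
apply: le_lt_trans (ler_normD _ _) _; rewrite !normrZ (ger0_norm t0).
rewrite ger0_norm ?subr_ge0 //.
have [m [pm qm mlt]] : exists m, [/\ `|p - c| <= m, `|q - c| <= m & m < eps].
  move: (`|p - c|) (`|q - c|) pc qc => A B Ae Be; exists (Num.max A B).
  by split; rewrite ?gt_max ?Ae ?Be ?le_max ?lexx ?orbT.
by apply: le_lt_trans mlt; nra.
Qed.

(** [S] collects the times from which a simple polygon leads to the end inside the allowed region.
    Near the infimum of [S] one short segment leads from an earlier time to a member of [S], so the
    infimum can only be [a], and it belongs to [S]. *)
Lemma simple_tube (g : R -> P) (a b eps : R) (l : seq P) : continuous g -> a <= b ->
  0 < eps -> simple (g b) l -> exists l', [/\ simple (g a) l', last (g a) l' = last (g b) l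
    & poly (g a) l' `<=` tube g a b eps `|` poly (g b) l].
Proof.
move=> cg ab eps0 sl.
pose S := [set s | a <= s <= b /\ exists l', [/\ simple (g s) l', last (g s) l' = last (g b) l
    & poly (g s) l' `<=` tube g a b eps `|` poly (g b) l]].
have Sb : S b by split; [rewrite ab lexx|exists l; split=> // z; right].
have lbS : lbound S a by move=> s [/andP[]].
have infS : has_inf S by split; [exists b|exists a].
have ai : a <= inf S by apply: lb_le_inf => //; exists b.
have ib : inf S <= b by apply: ge_inf => //; exists a.
have /cvgrPdist_lt/(_ _ eps0)/nbhs_ballP[d /= d0 near_i] := cg (inf S).
have [s Ss si] := inf_adherent d0 infS.
pose j := Num.max a (inf S - d / 2).
have jS : S j.
  have [/andP[as_ sb] [l' [sl' ll' pl']]] := Ss.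
  have jb : j <= b by rewrite ge_max ab lerBlDr (le_trans ib) // lerDl divr_ge0 // ltW.
  split; first by rewrite le_max lexx jb.
  have [l'' [sl'' ll'' pl'']] := simple_cons (g j) sl'.
  exists l''; split=> //; first by rewrite ll''.
  move=> z /pl''[zs|/pl'//]; left; exists (inf S); first by rewrite ai ib.
  apply: seg_near zs; rewrite distrC; apply: near_i; rewrite /ball /=.
    rewrite ltr_norml /j; have [h|h] := leP a (inf S - d / 2); apply/andP; split; lra.
  have : inf S <= s by apply: ge_inf => //; exists a.
  by move=> is_; rewrite ltr_norml; apply/andP; split; lra.
have ij : inf S <= j by apply: ge_inf => //; exists a.
have ja : j = a by move: ij; rewrite /j; have [h|h] := leP a (inf S - d / 2) => //; lra.
by case: jS => _; rewrite ja.
Qed.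

End Polygonal.

Section PolygonalDrawing.
Variables (R : realType) (V E : finType) (e1 e2 : E -> V).
Local Notation P := (R * R)%type.

(** Arcs and polygons coexist: contraction collapses the polygon of one edge while the others keep
    their arcs, and the dual is made of the polygons of all edges. A polygon may meet the arc of its
    own edge. *)
Record polygonal (pos : V -> P) (arc : E -> R -> P) (l : E -> seq P) : Prop := Polygonal {
  polygonal_simple : forall e, simple (pos (e1 e)) (l e);
  polygonal_last : forall e, last (pos (e1 e)) (l e) = pos (e2 e);
  polygonal_pos : forall e w, poly (pos (e1 e)) (l e) (pos w) -> w = e1 e \/ w = e2 e;
  polygonal_arc : forall e f t, e <> f -> 0 < t < 1 -> ~ poly (pos (e1 e)) (l e) (arc f t);
  polygonal_disj : forall e f z, e <> f -> poly (pos (e1 e)) (l e) z ->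
    poly (pos (e1 f)) (l f) z -> exists w, z = pos w
}.

Lemma polygonal_drawing pos arc : (forall e, e1 e <> e2 e) -> injective pos ->
  draws e1 e2 pos arc ->
  exists arc' l, draws e1 e2 pos arc' /\ polygonal pos arc' l.
Proof.
move=> loopfree ipos /(radial_drawing loopfree ipos)[{}arc [a [b [r [r0 D ab Z mid]]]]].
have a0 e : 0 < a e by case: (ab e).
have aLb e : a e < b e by case: (ab e).
have b1 e : b e < 1 by case: (ab e).
have arc_pos e t w : 0 <= t <= 1 -> arc e t = pos w -> w = e1 e \/ w = e2 e.
  move=> /andP[]; rewrite !le_eqVlt => /predU1P[<- _|t0 /predU1P[->|t1]].
  - by rewrite (draws_0 D) => /ipos ->; left.
  - by rewrite (draws_1 D) => /ipos ->; right.
  - by move=> tw; case: (draws_pos D (e := e) (v := w) (t := t)); rewrite ?t0.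
have arc_arc e f s t : e <> f -> 0 <= s <= 1 -> 0 <= t <= 1 -> arc e s = arc f t ->
    exists w, arc e s = pos w.
  move=> ef /andP[s0 s1] t01 est.
  move: (s0); rewrite le_eqVlt => /predU1P[<-|{}s0]; first by exists (e1 e); rewrite (draws_0 D).
  move: (s1); rewrite le_eqVlt => /predU1P[->|{}s1]; first by exists (e2 e); rewrite (draws_1 D).
  rewrite est; case/andP: t01 => t0 t1.
  move: (t0); rewrite le_eqVlt => /predU1P[<-|{}t0]; first by exists (e1 f); rewrite (draws_0 D).
  move: (t1); rewrite le_eqVlt => /predU1P[->|{}t1]; first by exists (e2 f); rewrite (draws_1 D).
  by case: (draws_arc D (e := e) (f := f) (s := s) (t := t)); rewrite ?s0 ?t0.
have ab01 e s : a e <= s <= b e -> 0 < s < 1.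
  by move=> /andP[sa sb]; rewrite (lt_le_trans (a0 e) sa) (le_lt_trans sb (b1 e)).
have w01 (s : R) : 0 < s < 1 -> 0 <= s <= 1 by move=> /andP[/ltW-> /ltW->].
have mid_pos e s w : a e <= s <= b e -> arc e s <> pos w.
  by move=> /ab01; apply: (draws_pos D).
(* The factor 2 makes the tubes of distinct edges disjoint, and [eps <= r] keeps the vertices out of
   them. *)
have [eps eps0 [er Heps]] : exists2 eps, 0 < eps & eps <= r /\
    forall e f, e <> f -> forall s t, a e <= s <= b e -> 0 <= t <= 1 ->
      2 * eps <= `|arc e s - arc f t|.
  have [eps eps0 Heps] : exists2 r, 0 < r & forall ef : E * E, ef.1 <> ef.2 ->
      forall s t, a ef.1 <= s <= b ef.1 -> 0 <= t <= 1 -> 2 * r <= `|arc ef.1 s - arc ef.2 t|.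
    apply: uniform_radius => [[e f] k k' /andP[_ k'k] H ef s t sab t01|[e f]] /=.
      by apply: le_trans (H ef s t sab t01); rewrite ler_pM2l.
    have [->|/eqP ef] := eqVneq e f; first by exists 1.
    have [|k k0 Hk] := arcs_away (draws_cts D (e := e)) (draws_cts D (e := f)) (ltW (aLb e)).
      move=> s t sab t01 est; have s01 := w01 _ (ab01 _ _ sab).
      have [w] := arc_arc e f s t ef s01 t01 est.
      exact: mid_pos.
    exists (k / 2); first by rewrite divr_gt0.
    by move=> _ s t sab t01; rewrite mulrC divfK // Hk.
  exists (Num.min eps r); first by rewrite lt_min eps0.
  rewrite ge_min lexx orbT; split=> // e f ef s t sab t01.
  apply: le_trans (Heps (e, f) ef s t sab t01).
  by rewrite ler_pM2l // ge_min lexx.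
pose T e := tube (arc e) (a e) (b e) eps.
pose region e : set P := [set z | T e z \/ exists2 s, 0 <= s <= 1 & z = arc e s].
have T_pos e w : ~ T e (pos w).
  by move=> [s sab]; rewrite distrC ltNge (le_trans er) ?mid.
have T_arc e f t : e <> f -> 0 <= t <= 1 -> ~ T e (arc f t).
  move=> ef t01 [s sab]; rewrite distrC => lt.
  have := Heps _ _ ef s t sab t01; lra.
have T_T e f z : e <> f -> T e z -> ~ T f z.
  move=> ef [s sab zs] [t tab zt].
  have := Heps _ _ ef s t sab (w01 _ (ab01 _ _ tab)).
  have := ler_distD z (arc e s) (arc f t); rewrite [`|arc e s - z|]distrC; lra.
have /choice[l lP] : forall e, exists l, [/\ simple (pos (e1 e)) l,
    last (pos (e1 e)) l = pos (e2 e) & poly (pos (e1 e)) l `<=` region e].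
  move=> e; have [Z1 Z3] := Z e.
  (* The polygon is built backwards: the straight piece at the second end, then the tube, then the
     straight piece at the first end, with shortcuts wherever simplicity would fail. *)
  have sb : simple (arc e (b e)) [:: pos (e2 e)].
    by split=> //; apply: mid_pos; rewrite lexx ltW.
  have [l [sl ll pl]] := simple_tube (draws_cts D (e := e)) (ltW (aLb e)) eps0 sb.
  have [l' [sl' ll' pl']] := simple_cons (pos (e1 e)) sl.
  exists l'; split=> //; first by rewrite ll' ll.
  have in1 s : 0 <= s <= a e -> 0 <= s <= 1.
    move=> /andP[-> sa] /=; apply: le_trans sa (ltW (lt_trans (aLb e) (b1 e))).
  move=> z /pl'[[t /andP[t0 t1] ->]|/pl[zT|[[t /andP[t0 t1] ->]|->]]].
  - right; exists (t * a e).
      have a0' := ltW (a0 e).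
      by apply: in1; apply/andP; split; [exact: mulr_ge0|exact: ler_piMl].
    have ta : t * a e <= a e by apply: ler_piMl => //; apply/ltW.
    by rewrite (Z1 _ ta) mulfK // gt_eqF.
  - by left.
  - right; exists (b e + t * (1 - b e)).
      have := b1 e; have := a0 e; have := aLb e => *.
      by apply/andP; split; nra.
    have tb : b e <= b e + t * (1 - b e) by have := b1 e; nra.
    rewrite (Z3 _ tb).
    have b0 : 1 - b e != 0 by rewrite subr_eq0 gt_eqF.
    have -> : (1 - (b e + t * (1 - b e))) / (1 - b e) = 1 - t by field.
    by congr pair; rewrite /= /GRing.scale /=; ring.
  - by right; exists 1; rewrite ?ler01 ?lexx // (draws_1 D).
exists arc, l; split=> //; split.
- by move=> e; case: (lP e).
- by move=> e; case: (lP e).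
- move=> e w; case: (lP e) => _ _ sub /sub[/T_pos//|[s s01 /esym]]; exact: arc_pos.
- move=> e f t ef t01; case: (lP e) => _ _ sub /sub[/(T_arc _ _ _ ef (w01 _ t01))//|[s s01 fe]].
  have [w fw] := arc_arc f e t s (nesym ef) (w01 _ t01) s01 fe.
  exact: (draws_pos D t01 fw).
- move=> e f z ef; case: (lP e) => _ _ sube; case: (lP f) => _ _ subf.
  move=> /sube[zT|[s s01 zs]] /subf[zT'|[t t01 zt]].
  + by case: (T_T _ _ _ ef zT).
  + by case: (T_arc _ _ _ ef t01); rewrite -zt.
  + by case: (T_arc _ _ _ (nesym ef) s01); rewrite -zs.
  + by rewrite zs; apply: arc_arc ef s01 t01 _; rewrite -zs.
Qed.

End PolygonalDrawing.

(** * Contraction of an edge of a planar graph *)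

Section Contraction.
Variables (R : realType) (G : mgraph).
Hypotheses (Gl : loopless G) (Gp : planar R G).
Variable e0 : edge G.

Let u := end1 e0.
Let v := end2 e0.

Lemma merge_neq x : (if x == v then u else x) != v.
Proof. by case: ifP => [_|->] //; apply: Gl. Qed.

Definition merge (x : vertex G) : {x | x != v} := exist (fun x => x != v) _ (merge_neq x).

Lemma val_merge x : val (merge x) = if x == v then u else x. Proof. by []. Qed.

(** Edges parallel to [e0] would become loops; they are dropped together with it. *)
Definition contracted : mgraph :=
  @MGraph {x | x != v} {f : edge G | merge (end1 f) != merge (end2 f)}
    (fun f => merge (end1 (val f))) (fun f => merge (end2 (val f))).

Lemma contracted_loopless : loopless contracted.
Proof. by move=> f; apply: (valP f). Qed.

Lemma card_contracted : (#|vertex contracted| < #|vertex G|)%N.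
Proof.
rewrite /= card_sig -(cardC (pred1 v)) card1 add1n ltnS.
by apply: subset_leq_card; apply/fintype.subsetP => x.
Qed.

Lemma contracted_planar : planar R contracted.
Proof.
have [pos [arc [ipos D]]] := (planar_draws R G).1 Gp.
have lf e : end1 e <> end2 e :> vertex G by apply/eqP; apply: Gl.
have [{}arc [l [{}D L]]] := polygonal_drawing lf ipos D.
pose i (f : edge contracted) : edge G := val f.
have ne0 f : e0 <> i f.
  move=> e; have /negP := valP f; apply; rewrite -/(i f) -e.
  by apply/eqP/val_inj; rewrite !val_merge eqxx; case: ifP.
(* The edges to be dropped are removed before the collapse, which requires all open arcs to avoid
   the polygon of [e0]. *)
have Di : draws (@end1 G \o i) (@end2 G \o i) pos (arc \o i).
  split=> /=.
  - by move=> f; apply: (draws_cts D).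
  - by move=> f; apply: (draws_0 D).
  - by move=> f; apply: (draws_1 D).
  - by move=> f s t; apply: (draws_inj D).
  - by move=> f w t; apply: (draws_pos D).
  - by move=> f g s t fg; apply: (draws_arc D) => /val_inj.
have [||pos' [arc' [D' uv' sep]]] := contract_polygon Di ipos (lf e0)
  (polygonal_simple L e0) (polygonal_last L e0).
- by move=> f t; apply: (polygonal_arc L).
- by move=> w; apply: (polygonal_pos L).
have pm x : pos' (val (merge x)) = pos' x.
  by rewrite val_merge; case: eqP => [->|].
apply/planar_draws; exists (pos' \o val), arc'; split.
  move=> [x xv] [y yv] /= /sep[xy|[xuv yuv]]; apply/val_inj => //=.
  case: xuv xv => [->|->]; last by rewrite eqxx.
  by case: yuv yv => [->|->] //; rewrite eqxx.
split=> /=.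
- by move=> f; apply: (draws_cts D').
- by move=> f; rewrite (draws_0 D') pm.
- by move=> f; rewrite (draws_1 D') pm.
- by move=> f; apply: (draws_inj D').
- by move=> f w; apply: (draws_pos D').
- by move=> f g s t; apply: (draws_arc D').
Qed.

End Contraction.

(** An edge whose ends have equal labels is contracted, and [h] descends to the quotient. The edges
    dropped with it also have equal labels, and their ends receive the same color. When no such edge
    is left, any proper coloring will do. *)
Lemma relative_coloring (R : realType) :
  (forall G : mgraph, loopless G -> planar R G -> four_colorable G) ->
  forall (K : eqType) (G : mgraph) (h : vertex G -> K), loopless G -> planar R G ->
  exists c : vertex G -> 'I_4,
    forall e : edge G, (c (end1 e) == c (end2 e)) = (h (end1 e) == h (end2 e)).
Proof.
move=> col K G; have [n] := ubnP #|vertex G|.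
elim: n => // n IH in G *; rewrite ltnS => leGn h Gl Gp.
have [/existsP[e0 /eqP he0]|nh] :=
  boolP [exists e : edge G, h (end1 e) == h (end2 e)]; last first.
  have [c cP] := col G Gl Gp; exists c => e.
  by rewrite (negPf (cP e)); apply/esym/negbTE; apply: contra nh => he; apply/existsP; exists e.
have [c cP] := IH (contracted Gl e0) (leq_trans (card_contracted Gl e0) leGn)
  (fun x => h (val x)) (@contracted_loopless _ Gl e0) (contracted_planar Gl Gp e0).
have hm x : h (val (merge Gl e0 x)) = h x by rewrite val_merge; case: eqP => [->|].
exists (fun x => c (merge Gl e0 x)) => e.
have [mm|mm] := eqVneq (merge Gl e0 (end1 e)) (merge Gl e0 (end2 e)).
  by rewrite mm -(hm (end1 e)) -(hm (end2 e)) mm !eqxx.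
by have := cP (exist _ e mm); rewrite /= !hm.
Qed.

(** * The dual of a polygonal drawing *)

Section CutSpace.
Variables (V E : finType) (e1 e2 : E -> V).

Definition incident (v : V) (e : E) : bool := (e1 e == v) (+) (e2 e == v).

Definition even_edges (Z : {set E}) : bool :=
  [forall v, ~~ \big[addb/false]_(e in Z) incident v e].

(** Regrouping by vertices: the cycle space is orthogonal to the cut space. *)
Lemma even_sum (Z : {set E}) (g : V -> bool) : even_edges Z ->
  \big[addb/false]_(e in Z) (g (e1 e) (+) g (e2 e)) = false.
Proof.
move=> /forallP Ze.
have gE e : g (e1 e) (+) g (e2 e) = \big[addb/false]_v (g v && incident v e).
  under eq_bigr do rewrite /incident andb_addr.
  rewrite big_split /= (bigD1 (e1 e)) //= eqxx andbT big1; last first.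
    by move=> v /negPf; rewrite eq_sym => ->; rewrite andbF.
  rewrite (bigD1 (e2 e)) //= eqxx andbT big1 ?addbF // => v /negPf.
  by rewrite eq_sym => ->; rewrite andbF.
rewrite (eq_bigr _ (fun e _ => gE e)) exchange_big big1 // => v _.
case: (g v); last by rewrite big1.
by apply/negbTE/Ze.
Qed.

Lemma F2_addb (x y : 'F_2) : (x + y != 0) = (x != 0) (+) (y != 0).
Proof. by case: x => [[|[|]]] //= ?; case: y => [[|[|]]]. Qed.

Lemma F2_mul (x y : 'F_2) : (x * y != 0) = (x != 0) && (y != 0).
Proof. by rewrite mulf_eq0 negb_or. Qed.

Lemma F2_sum (I : finType) (F : I -> 'F_2) :
  (\sum_i F i != 0) = \big[addb/false]_i (F i != 0).
Proof. by apply: (big_morph (fun x : 'F_2 => x != 0) F2_addb). Qed.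

Lemma F2_bool (c : bool) : (c%:R != 0 :> 'F_2) = c.
Proof. by case: c. Qed.

(** Over F_2 the row space of the incidence matrix [N] is the space of cuts, and a row belongs to it
    as soon as it is killed by [cokermx N], whose columns are even edge sets because
    [N *m cokermx N = 0]. *)
Lemma cut_of_orthogonal (J : {set E}) :
  (forall Z, even_edges Z -> \big[addb/false]_(e in J) (e \in Z) = false) ->
  exists A : {set V}, forall e, (e \in J) = (e1 e \in A) (+) (e2 e \in A).
Proof.
move=> orth.
pose N : 'M['F_2]_(#|V|, #|E|) := \matrix_(i, j) (incident (enum_val i) (enum_val j))%:R.
pose r : 'rV['F_2]_#|E| := \row_j (enum_val j \in J)%:R.
have NE i j : N i j = (incident (enum_val i) (enum_val j))%:R by rewrite mxE.
have rE i j : r i j = (enum_val j \in J)%:R by rewrite mxE.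
have /submxP[y yN] : (r <= N)%MS.
  rewrite submxE; apply/eqP/matrixP => i k; rewrite !mxE.
  pose Z := [set e : E | cokermx N (enum_rank e) k != 0]%SET.
  have Ze : even_edges Z.
    apply/forallP => v; have /matrixP/(_ (enum_rank v) k) := mulmx_coker N.
    rewrite !mxE => /(congr1 (fun x => x != 0)); rewrite eqxx F2_sum /= => H.
    apply/negbT; rewrite -[RHS]H.
    rewrite big_mkcond (reindex (fun j : 'I_#|E| => enum_val j)) /=; last first.
      by exists enum_rank => x _; rewrite ?enum_valK ?enum_rankK.
    apply: eq_bigr => j _; rewrite finset.in_set enum_valK.
    by rewrite F2_mul NE enum_rankK F2_bool andbC; case: ifP.
  apply/eqP/negbNE; apply/negbT; rewrite -[RHS](orth Z Ze) F2_sum.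
  rewrite [RHS]big_mkcond [RHS](reindex (fun j : 'I_#|E| => enum_val j)) /=; last first.
    by exists enum_rank => x _; rewrite ?enum_valK ?enum_rankK.
  apply: eq_bigr => j _; rewrite finset.in_set enum_valK.
  by rewrite F2_mul rE F2_bool; case: ifP.
exists [set v | y 0 (enum_rank v) != 0]%SET => e.
have /matrixP/(_ 0 (enum_rank e))/(congr1 (fun x => x != 0)) := yN.
rewrite !mxE enum_rankK F2_bool => ->; rewrite F2_sum !finset.in_set.
rewrite (reindex (fun v : V => enum_rank v)) /=; last first.
  by exists enum_val => x _; rewrite ?enum_valK ?enum_rankK.
transitivity (\big[addb/false]_v ((y 0 (enum_rank v) != 0) && incident v e)).
  by apply: eq_bigr => v _; rewrite F2_mul mxE !enum_rankK F2_bool.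
under eq_bigr do rewrite /incident andb_addr.
rewrite big_split /= (bigD1 (e1 e)) //= eqxx andbT big1; last first.
  by move=> v /negPf; rewrite eq_sym => ->; rewrite andbF.
rewrite (bigD1 (e2 e)) //= eqxx andbT big1 ?addbF // => v /negPf.
by rewrite eq_sym => ->; rewrite andbF.
Qed.

End CutSpace.

(** * Segments of simple polygons, generic shears and telescoping sums *)

Section SimplePolygons.
Variable R : realType.
Local Notation P := (R * R)%type.
Implicit Types (p q z : P) (l : seq P).

Lemma seg_poly (x0 : P) p l j : (j < size l)%N ->
  seg (nth x0 (p :: l) j) (nth x0 l j) `<=` poly p l.
Proof.
elim: l p j => [|q l IH] p [|j] //= jl z zs.
by right; exact: (IH q j jl).
Qed.

Lemma mem_poly p l z : z \in p :: l -> poly p l z.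
Proof.
elim: l p => [|q l IH] p; first by rewrite inE => /eqP.
rewrite in_cons => /predU1P[->|zl]; first exact: poly_start.
by right; apply: IH.
Qed.

Lemma simple_uniq p l : simple p l -> uniq (p :: l).
Proof.
elim: l p => [|q l IH] p //= [pq sq sl]; apply/andP; split; last exact: IH.
apply/negP => /mem_poly pl; apply: pq.
by apply: sq pl; apply: seg_start.
Qed.

Lemma simple_inner (x0 : P) p l i k z : simple p l -> (i < size l)%N -> 0 < k < 1 ->
  z = nth x0 (p :: l) i + k *: (nth x0 l i - nth x0 (p :: l) i) ->
  [/\ z <> p, z <> last p l & forall j, (j < size l)%N -> j <> i ->
    ~ seg (nth x0 (p :: l) j) (nth x0 l j) z].
Proof.
elim: l p i => [|q l IH] p i //= [pq sq sl] il k01 zE.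
have k01' : 0 <= k <= 1 by case/andP: k01 => /ltW-> /ltW->.
have k0 : k != 0 by case/andP: k01 => k0 _; rewrite gt_eqF.
have k1 : 1 - k != 0 by case/andP: k01 => _ k1; rewrite subr_eq0 gt_eqF.
case: i il zE => [|i] il zE; rewrite /= in zE.
  have zs : seg p q z by exists k.
  have zq : z <> q.
    move=> zq; apply: pq; apply/eqP; rewrite eq_sym -subr_eq0.
    have : (1 - k) *: (q - p) == 0.
      by rewrite scalerBl scale1r -addrA -opprD -zE zq subrr.
    by rewrite scaler_eq0 (negPf k1).
  have nz : ~ poly q l z by move=> /(sq _ zs).
  split.
  - move=> zp; apply: pq; apply/eqP; rewrite eq_sym -subr_eq0.
    have : k *: (q - p) == 0 by rewrite -[X in X == _](addBK p) -zE zp subrr.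
    by rewrite scaler_eq0 (negPf k0).
  - by move=> zl; apply: nz; rewrite zl; apply: poly_end.
  - by move=> [|j] // jl _ zj; apply: nz; apply: (seg_poly jl zj).
have [zq zl zj] := IH q i sl il k01 zE.
have zp : poly q l z by apply: (@seg_poly x0 q l i il); exists k.
split=> //.
- by move=> zp'; apply: zq; apply: sq zp; rewrite zp'; apply: seg_start.
- move=> [|j] jl ji; first by move=> /= /sq/(_ zp).
  by apply: zj => // ji'; apply: ji; rewrite ji'.
Qed.

Lemma sum_path (x0 : P) p l (g : P -> bool) :
  \big[addb/false]_(i < size l) (g (nth x0 (p :: l) i) (+) g (nth x0 l i)) =
  g p (+) g (last p l).
Proof.
elim: l p => [|q l IH] p; first by rewrite big_ord0 addbb.
rewrite [LHS]big_ord_recl /= (eq_bigr (fun i : 'I_(size l) =>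
  g (nth x0 (q :: l) i) (+) g (nth x0 l i))) => [|i _ //].
by rewrite IH addbA addbK.
Qed.

(** Points with different ordinates share a sheared abscissa for one value of [eps] only, and [eps]
    is chosen above all these values. Afterwards no segment is vertical and no vertical line
    contains two polygon vertices. *)
Lemma generic_shear (W : seq P) : exists eps : R, forall w w', w \in W -> w' \in W ->
  w.1 + eps * w.2 = w'.1 + eps * w'.2 -> w = w'.
Proof.
pose bad (ww : P * P) : R := - (ww.1.1 - ww.2.1) / (ww.1.2 - ww.2.2).
pose eps := 1 + \sum_(ww <- [seq (w, w') | w <- W, w' <- W]) `|bad ww|.
have epsP ww : ww \in [seq (w, w') | w <- W, w' <- W] -> bad ww < eps.
  move=> wW; apply: le_lt_trans (ler_norm _) _.
  rewrite /eps (big_rem ww) //= ltr_pwDl // lerDl.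
  by apply: sumr_ge0.
exists eps => w w' wW wW' e.
have [e2|e2] := eqVneq w.2 w'.2.
  rewrite [w]surjective_pairing [w']surjective_pairing e2; congr pair.
  by move: e; rewrite e2 => /addIr.
have := epsP (w, w') (allpairs_f pair wW wW'); rewrite /bad /=.
have -> : - (w.1 - w'.1) = eps * (w.2 - w'.2) by lra.
by rewrite mulfK ?ltxx // subr_eq0.
Qed.

End SimplePolygons.

(** A telescoping sum: in the order of [h], the elements at or above [s] are those strictly above
    its predecessor. The induction removes the minimum. *)
Lemma sum_prefixes (R : realDomainType) (I : finType) (h : I -> R) (f : {set I} -> bool)
    (A : {set I}) : {in A &, injective h} ->
  \big[addb/false]_(s in A) (f [set s' in A | h s < h s']%SET (+)
                             f [set s' in A | h s <= h s']%SET) =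
  f finset.set0 (+) f A.
Proof.
have [n] := ubnP #|A|; elim: n => // n IH in A *; rewrite ltnS => leAn inj.
have [->|[m0 m0A]] := set_0Vmem A; first by rewrite big_set0 addbb.
have [m mA mmin] := @Order.TotalTheory.arg_minP _ _ _ m0 (mem A) h m0A.
have {}mA : m \in A by [].
have ltm s : s \in (A :\ m)%SET -> h m < h s.
  rewrite finset.in_setD1 => /andP[sm sA]; rewrite lt_def mmin // andbT.
  by apply: contra sm => /eqP /inj ->.
have inD s : s \in A -> (s \in (A :\ m)%SET) = (s != m).
  by move=> sA; rewrite finset.in_setD1 sA andbT.
rewrite (bigD1 m) //=; have -> : [set s' in A | h m < h s']%SET = (A :\ m)%SET.
  apply/setP => s; rewrite in_sep; case sA: (s \in A) => /=; last first.
    by rewrite finset.in_setD1 sA andbF.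
  rewrite inD //; have [->|sm] := eqVneq s m; first by rewrite ltxx.
  by apply: ltm; rewrite inD.
have -> : [set s' in A | h m <= h s']%SET = A.
  apply/setP => s; rewrite in_sep; case sA: (s \in A) => //=.
  exact: mmin.
have := IH (A :\ m)%SET; rewrite (cardsD1 m) mA in leAn => /(_ leAn) IHA.
rewrite (eq_bigl (fun s => s \in (A :\ m)%SET)); last first.
  by move=> s; rewrite finset.in_setD1 andbC.
rewrite (eq_bigr (fun s => f [set s' in A :\ m | h s < h s']%SET (+)
                           f [set s' in A :\ m | h s <= h s']%SET)); last first.
  move=> s sA; have ms := ltm s sA; congr (f _ (+) f _); apply/setP => s';
    rewrite !in_sep finset.in_setD1; have [->|//] := eqVneq s' m.
    by rewrite mA /= ltNge ltW.
  by rewrite mA /= leNgt ms.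
rewrite IHA; last by move=> s s' /finset.setD1P[_ sA] /finset.setD1P[_ sA']; apply: inj.
by case: (f _); case: (f _); case: (f _).
Qed.

Lemma small_gap (R : realFieldType) (W : seq R) :
  exists2 d, 0 < d & forall x, x \in W -> x != 0 -> d < `|x|.
Proof.
elim: W => [|y W [d d0 dW]]; first by exists 1.
have [y0|y0] := eqVneq y 0.
  by exists d => // x; rewrite in_cons => /predU1P[->|/dW//]; rewrite y0 eqxx.
exists (Num.min d (`|y| / 2)); first by rewrite lt_min d0 divr_gt0 ?normr_gt0.
move=> x; rewrite in_cons => /predU1P[->|xW] x0.
  by rewrite gt_min ltr_pdivrMr // ltr_pMr ?normr_gt0 // ltr1n orbT.
by rewrite gt_min dW.
Qed.

(** * Faces of a polygonal drawing by winding parities *)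

Section DualOfDrawing.
Variables (R : realType) (V E : finType) (e1 e2 : E -> V).
Local Notation P := (R * R)%type.
Variables (pos : V -> P) (arc : E -> R -> P) (l : E -> seq P).
Hypotheses (loopfree : forall e, e1 e <> e2 e) (ipos : injective pos)
  (L : polygonal e1 e2 pos arc l).

Let x0 : P := (0, 0).
Let path e := pos (e1 e) :: l e.

Definition segment := {e : E & 'I_(size (l e))}.
Definition start (s : segment) : P := nth x0 (path (tag s)) (tagged s).
Definition stop (s : segment) : P := nth x0 (l (tag s)) (tagged s).

Lemma start_in s : start s \in path (tag s).
Proof. by rewrite mem_nth //= ltnS ltnW. Qed.

Lemma stop_in s : stop s \in path (tag s).
Proof. by rewrite in_cons mem_nth ?orbT. Qed.

Lemma start_neq_stop s : start s <> stop s.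
Proof.
case: s => e i se.
have /(uniqP x0) inj := simple_uniq (polygonal_simple L e).
have := inj i i.+1; rewrite !inE /= !ltnS (ltnW (ltn_ord i)) ltn_ord => /(_ isT isT se).
by move=> /eqP; rewrite eq_sym eqn_leq ltnn.
Qed.

Lemma segments_disjoint s s' k z : s <> s' -> 0 < k < 1 ->
  z = start s + k *: (stop s - start s) -> ~ seg (start s') (stop s') z.
Proof.
case: s => e i; case: s' => e' i' ss' k01 zE.
have [zp zl zj] := simple_inner (polygonal_simple L e) (ltn_ord i) k01 zE.
have k01' : 0 <= k <= 1 by case/andP: k01 => /ltW-> /ltW->.
have [ee|ee] := pselect (e = e').
  subst e'; apply: zj => // ii; apply: ss'; congr existT; exact: val_inj.
move=> zs'; have pz : poly (pos (e1 e)) (l e) z.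
  by apply: (@seg_poly _ x0 _ _ i (ltn_ord i)); exists k.
have pz' := seg_poly (ltn_ord i') zs'.
have [w zw] := polygonal_disj L ee pz pz'.
rewrite zw in pz; case: (polygonal_pos L pz) => we.
  by apply: zp; rewrite zw we.
by apply: zl; rewrite zw we (polygonal_last L).
Qed.

Lemma sum_segments (Z : {set E}) (g : P -> bool) :
  \big[addb/false]_(s : segment | tag s \in Z) (g (start s) (+) g (stop s)) =
  \big[addb/false]_(e in Z) (g (pos (e1 e)) (+) g (pos (e2 e))).
Proof.
transitivity (\big[addb/false]_(e in Z) \big[addb/false]_(i < size (l e))
   (g (nth x0 (path e) i) (+) g (nth x0 (l e) i))); last first.
  by apply: eq_bigr => e _; rewrite sum_path (polygonal_last L).
rewrite (sig_big_dep (mem Z) (fun _ _ => true)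
  (fun e (i : 'I_(size (l e))) => g (nth x0 (path e) i) (+) g (nth x0 (l e) i))) /=.
by apply: eq_bigl => s; rewrite andbT.
Qed.

Lemma sum_segments_even (Z : {set E}) (g : P -> bool) : even_edges e1 e2 Z ->
  \big[addb/false]_(s : segment | tag s \in Z) (g (start s) (+) g (stop s)) = false.
Proof. by move=> Ze; rewrite sum_segments (even_sum (fun v => g (pos v)) Ze). Qed.

Variable eps : R.
Let X (w : P) := w.1 + eps * w.2.
Let isPt w := exists e, w \in path e.
Hypothesis injX : forall w w', isPt w -> isPt w' -> X w = X w' -> w = w'.

Let XA s := X (start s).
Let XB s := X (stop s).

Let pt_start s : isPt (start s). Proof. by exists (tag s); apply: start_in. Qed.
Let pt_stop s : isPt (stop s). Proof. by exists (tag s); apply: stop_in. Qed.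

Let XAB s : XB s - XA s != 0.
Proof.
by rewrite subr_eq0; apply/eqP => /injX e; apply: (@start_neq_stop s); apply/esym/e.
Qed.

Definition height (s : segment) (t : R) : R :=
  (start s).2 + (t - XA s) / (XB s - XA s) * ((stop s).2 - (start s).2).

Definition spans (s : segment) (t : R) : bool := (XA s < t) (+) (XB s < t).

Definition generic (t : R) : Prop := forall w, isPt w -> X w <> t.

Let heightE s k : height s (XA s + k * (XB s - XA s)) =
  (start s + k *: (stop s - start s)).2.
Proof. by rewrite /height addBK mulfK. Qed.

Let XE s k : X (start s + k *: (stop s - start s)) = XA s + k * (XB s - XA s).
Proof. by rewrite /XA /XB /X /= /GRing.scale /=; ring. Qed.

Lemma height_neq s s' k k' t : s <> s' -> 0 < k < 1 -> 0 <= k' <= 1 ->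
  t = XA s + k * (XB s - XA s) -> t = XA s' + k' * (XB s' - XA s') ->
  height s t <> height s' t.
Proof.
move=> ss' k01 k01' tk tk' hh.
apply: (segments_disjoint ss' k01 erefl); exists k' => //.
have h2 : (start s + k *: (stop s - start s)).2 = (start s' + k' *: (stop s' - start s')).2.
  by rewrite -!heightE -tk -tk'.
have h1 := XE s k; have h1' := XE s' k'; rewrite -tk in h1; rewrite -tk' -h1 /X h2 in h1'.
rewrite [LHS]surjective_pairing [RHS]surjective_pairing h2; congr pair.
by apply/esym; apply: addIr h1'.
Qed.

Let spans_inner s t : generic t -> spans s t ->
  exists2 k, 0 < k < 1 & t = XA s + k * (XB s - XA s).
Proof.
move=> gt st; exists ((t - XA s) / (XB s - XA s)); last by rewrite divfK // addrC subrK.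
have /eqP At := gt _ (pt_start s); have /eqP Bt := gt _ (pt_stop s).
move: st; rewrite /spans -/(XA s) -/(XB s) in At Bt *.
case: ltgtP At => // At _; case: ltgtP Bt => // Bt _ _.
  by rewrite divr_gt0 ?ltr_pdivrMr ?mul1r ?subr_gt0 ?ltrD2r // (lt_trans At).
have d0 : XB s - XA s < 0 by rewrite subr_lt0 (lt_trans Bt).
by rewrite -mulrNN -invrN divr_gt0 ?ltr_pdivrMr ?mul1r ?oppr_gt0 ?ltrN2 ?ltrD2r // subr_lt0.
Qed.

Definition above (s s' : segment) (t : R) : bool := spans s' t && (height s t < height s' t).

(* On an interval of abscissas where both are defined, the heights of two
   segments are affine functions that never agree. *)
Let above_const s s' t t' : generic t -> generic t' -> spans s t -> spans s t' ->
  t <= t' -> s <> s' ->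
  exists b, forall u k', t <= u <= t' -> 0 <= k' <= 1 -> u = XA s' + k' * (XB s' - XA s') ->
    (height s u < height s' u) = b.
Proof.
move=> gt gt' st st' tt' ss'.
pose J u := t <= u <= t' /\ exists2 k', 0 <= k' <= 1 & u = XA s' + k' * (XB s' - XA s').
have [k k01 tk] := spans_inner gt st; have [k' k01' tk'] := spans_inner gt' st'.
have neq u : J u -> height s u != height s' u.
  move=> [/andP[tu ut'] [k2 k201 uk2]]; apply/eqP.
  apply: (@height_neq s s' ((u - XA s) / (XB s - XA s)) k2) => //; last first.
    by rewrite divfK // addrC subrK.
  have [d0|d0] := ltP 0 (XB s - XA s).
    rewrite ltr_pdivlMr // ltr_pdivrMr // mul0r mul1r.
    case/andP: k01 => k0 k1; case/andP: k01' => k0' k1'.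
    by apply/andP; split; nra.
  have {}d0 : XB s - XA s < 0 by rewrite lt_def eq_sym XAB.
  rewrite ltr_ndivlMr // ltr_ndivrMr // mul0r mul1r.
  case/andP: k01 => k0 k1; case/andP: k01' => k0' k1'.
  by apply/andP; split; nra.
have conv u v c : J u -> J v -> 0 <= c <= 1 -> J (u + c * (v - u)).
  move=> [/andP[tu ut'] [ku ku01 uE]] [/andP[tv vt'] [kv kv01 vE]] /andP[c0 c1]; split.
    by apply/andP; split; nra.
  exists (ku + c * (kv - ku)); last by rewrite {1}uE {1}vE uE; ring.
  case/andP: ku01 => ? ?; case/andP: kv01 => ? ?.
  by apply/andP; split; nra.
pose D u := height s' u - height s u.
have Daff u v c : D (u + c * (v - u)) = D u + c * (D v - D u).
  by rewrite /D /height; ring.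
have sgn u v : J u -> J v -> 0 < D u -> 0 < D v.
  move=> Ju Jv Du; rewrite ltNge; apply/negP => Dv.
  have d0 : 0 < D u - D v by lra.
  have c01 : 0 <= D u / (D u - D v) <= 1.
    by rewrite (divr_ge0 (ltW Du) (ltW d0)) /= ler_pdivrMr // mul1r; lra.
  have := neq _ (conv _ _ _ Ju Jv c01); rewrite eq_sym -subr_eq0 -/(D _) Daff.
  have -> : D u + D u / (D u - D v) * (D v - D u) = 0 by field; apply: lt0r_neq0.
  by rewrite eqxx.
have [[v Jv]|nJ] := pselect (exists v, J v); last first.
  by exists false => u k2 utt k201 uE; case: nJ; exists u; split=> //; exists k2.
exists (0 < D v) => u k2 utt k201 uE.
have Ju : J u by split=> //; exists k2.
by rewrite -subr_gt0; apply/idP/idP; apply: sgn.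
Qed.

(** A segment is gained or lost above [s] only when one of its ends lies between the two lines and
    above [s]. With [g] the indicator of that region, the change due to a segment is the sum of [g]
    at its ends, and such sums cancel over an even edge set. *)
Lemma above_transport (Z : {set E}) s t t' : even_edges e1 e2 Z ->
  generic t -> generic t' -> spans s t -> spans s t' ->
  \big[addb/false]_(s' : segment | tag s' \in Z) above s s' t =
  \big[addb/false]_(s' : segment | tag s' \in Z) above s s' t'.
Proof.
move=> Ze; wlog tt' : t t' / t <= t' => [wl gt gt' st st'|gt gt' st st'].
  by case/orP: (le_total t t') => le; [apply: wl|apply/esym/wl].
pose g w := ((X w < t) (+) (X w < t')) && (height s (X w) < w.2).
suff H s' : above s s' t (+) above s s' t' = g (start s') (+) g (stop s').
  have := sum_segments_even g Ze; rewrite -(eq_bigr _ (fun s' _ => H s')) big_split /=.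
  by move=> /negbT; rewrite negb_add => /eqP.
have dir s1 u : spans s1 u -> (XA s1 < u) = (XA s1 < XB s1) /\ (XB s1 < u) = (XB s1 < XA s1).
  rewrite /spans; case: (ltP (XA s1) u) => h1; case: (ltP (XB s1) u) => h2 // _.
    by split; apply/esym; [lra|apply/negbTE; rewrite -leNgt; lra].
  by split; apply/esym; [apply/negbTE; rewrite -leNgt; lra|lra].
have [->|/eqP ss'] := eqVneq s' s.
  rewrite /above !ltxx !andbF /g -/(XA s) -/(XB s).
  have [-> ->] := dir _ _ st; have [-> ->] := dir _ _ st'.
  by rewrite !addbb.
have [b Hb] := above_const gt gt' st st' tt' (nesym ss').
have aE u : t <= u <= t' -> generic u -> above s s' u = spans s' u && b.
  move=> utt gu; rewrite /above; case su: (spans s' u) => //=.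
  have [k' /andP[/ltW k0 /ltW k1] uE] := spans_inner gu su.
  by apply: (Hb u k') => //; rewrite k0.
have btw x : (x < t) (+) (x < t') -> t <= x <= t'.
  by case: (ltP x t) => h1; case: (ltP x t') => h2 // _; apply/andP; split; lra.
have gA : g (start s') = ((XA s' < t) (+) (XA s' < t')) && b.
  rewrite /g -/(XA s'); case bt: (_ (+) _) => //=.
  rewrite -(Hb (XA s') 0) ?btw ?lexx ?ler01 ?mul0r ?addr0 //.
  by rewrite /height subrr mul0r mul0r addr0.
have gB : g (stop s') = ((XB s' < t) (+) (XB s' < t')) && b.
  rewrite /g -/(XB s'); case bt: (_ (+) _) => //=.
  rewrite -(Hb (XB s') 1) ?btw ?lexx ?ler01 ?mul1r //; last by rewrite addrC subrK.
  have -> // : height s' (XB s') = (stop s').2.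
  by rewrite /height divff // mul1r addrC subrK.
rewrite !aE ?lexx ?tt' // gA gB /spans.
by case: b {Hb aE gA gB}; rewrite ?andbF // !andbT addbACA.
Qed.

Let Phi := {ffun {set E} -> bool}.

(** For [B] the segments above a point, these are the winding parities of the even edge sets around
    it. The value is false on other edge sets, so states that agree on even edge sets are equal. *)
Definition state (B : {set segment}) : Phi :=
  [ffun Z => even_edges e1 e2 Z && \big[addb/false]_(s in B) (tag s \in Z)].

(* The faces just above and just below [s], a face being known by the even edge
   sets that wind around it an odd number of times. *)
Definition upper s t := state [set s' | above s s' t]%SET.
Definition lower s t := state [set s' | spans s' t && (height s t <= height s' t)]%SET.

Let chi (S : {set Phi}) s t : bool := (upper s t \in S) (+) (lower s t \in S).

Let height_inj s s' t : generic t -> spans s t -> spans s' t ->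
  height s t = height s' t -> s = s'.
Proof.
move=> gt st st' hh; apply: contrapT => ss'.
have [k k01 tk] := spans_inner gt st.
have [k' /andP[/ltW k0 /ltW k1] tk'] := spans_inner gt st'.
by apply: (height_neq ss' k01 _ tk tk' hh); rewrite k0.
Qed.

(** On a generic line distinct segments have distinct heights, so going from above [s] to below it
    adds [s] alone. *)
Lemma lowerE s t Z : generic t -> spans s t -> even_edges e1 e2 Z ->
  lower s t Z = upper s t Z (+) (tag s \in Z).
Proof.
move=> gt st Ze; rewrite !ffunE Ze /= (bigD1 s) /=; last first.
  by rewrite finset.in_set st lexx.
rewrite addbC; congr (_ (+) _); apply: eq_bigl => s'.
rewrite !finset.in_set /above -andbA lt_def; case st': (spans s' t) => //=.
rewrite andbC; congr (_ && _).
by apply/idP/idP; apply: contra => /eqP; [move=> /(height_inj gt st' st)|] => ->.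
Qed.

Let upper_transport s t t' : generic t -> generic t' -> spans s t -> spans s t' ->
  upper s t = upper s t'.
Proof.
move=> gt gt' st st'; apply/ffunP => Z; rewrite !ffunE.
case Ze: (even_edges e1 e2 Z) => //=.
have := above_transport Ze gt gt' st st'.
rewrite big_mkcond [X in _ = X -> _]big_mkcond => H.
rewrite big_mkcond [RHS]big_mkcond; transitivity (\big[addb/false]_(i : segment)
  (if tag i \in Z then above s i t else false)).
  by apply: eq_bigr => i _; rewrite finset.in_set; case: (above _ _ _); case: (_ \in Z).
rewrite H; apply: eq_bigr => i _.
by rewrite finset.in_set; case: (above _ _ _); case: (_ \in Z).
Qed.

Let lower_transport s t t' : generic t -> generic t' -> spans s t -> spans s t' ->
  lower s t = lower s t'.
Proof.
move=> gt gt' st st'; apply/ffunP => Z.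
have [Ze|Ze] := boolP (even_edges e1 e2 Z); last by rewrite !ffunE (negPf Ze).
by rewrite !lowerE // (upper_transport gt gt' st st').
Qed.

(* On a vertical line, the states above the highest and below the lowest of the
   segments that cross it are both zero. *)
Let chi_line S t : generic t -> \big[addb/false]_(s | spans s t) chi S s t = false.
Proof.
move=> gt; pose A := [set s | spans s t]%SET.
rewrite (eq_bigl (mem A)); last by move=> s; rewrite inE /= finset.in_set.
rewrite (eq_bigr (fun s => (state [set s' in A | height s t < height s' t]%SET \in S) (+)
    (state [set s' in A | height s t <= height s' t]%SET \in S))); last first.
  move=> s _; congr ((state _ \in S) (+) (state _ \in S)); apply/setP => s'; by rewrite !finset.in_set.
rewrite (sum_prefixes (h := height^~ t) (fun B => state B \in S)); last first.
  by move=> s s'; rewrite !finset.in_set; apply: height_inj.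
suff -> : state A = state finset.set0 by rewrite addbb.
apply/ffunP => Z; rewrite !ffunE; case Ze: (even_edges e1 e2 Z) => //=.
rewrite big_set0 -[RHS](sum_segments_even (fun w => X w < t) Ze).
rewrite big_mkcond [RHS]big_mkcond; apply: eq_bigr => s _; rewrite finset.in_set.
by rewrite /spans; case: (_ (+) _); case: (_ \in Z).
Qed.

Let gap w0 : exists2 d, 0 < d & forall w, isPt w -> X w <> X w0 -> d < `|X w - X w0|.
Proof.
have [d d0 dW] := small_gap [seq X w - X w0 | w <- flatten [seq path e | e <- enum E]].
exists d => // w [e we] /eqP ww0; apply: dW; last by rewrite subr_eq0.
apply: map_f; apply/flatten_mapP; exists e => //; exact: mem_enum.
Qed.

Let generic_near w0 d : isPt w0 -> 0 < d ->
  (forall w, isPt w -> X w <> X w0 -> d < `|X w - X w0|) ->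
  generic (X w0 + d) /\ generic (X w0 - d).
Proof.
move=> pw0 d0 dW; split=> w pw ww0.
  have ne : X w0 + d <> X w0 by move=> e; lra.
  by have := dW w pw; rewrite ww0 => /(_ ne); rewrite addBK gtr0_norm // ltxx.
have ne : X w0 - d <> X w0 by move=> e; lra.
by have := dW w pw; rewrite ww0 => /(_ ne); rewrite addBK normrN gtr0_norm // ltxx.
Qed.

Let mid_ex s : exists t, generic t /\ spans s t.
Proof.
have [d d0 dW] := gap (start s).
have [g1 g2] := generic_near (pt_start s) d0 dW.
have dAB : d < `|XB s - XA s|.
  by apply: dW => //; apply/eqP; rewrite -subr_eq0; apply: XAB.
have [lt|le] := ltP (XA s) (XB s).
  exists (XA s + d); split=> //; rewrite /spans ltrDl d0 /=.
  by rewrite -leNgt; move: dAB; rewrite gtr0_norm ?subr_gt0 //; lra.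
exists (XA s - d); split=> //; rewrite /spans.
have -> : (XA s < XA s - d) = false by apply/negbTE; rewrite -leNgt; lra.
by move: dAB; rewrite ler0_norm ?subr_le0 //=; lra.
Qed.

Let mid s : R := projT1 (cid (mid_ex s)).
Let mid_generic s : generic (mid s). Proof. by rewrite /mid; case: cid => t []. Qed.
Let mid_spans s : spans s (mid s). Proof. by rewrite /mid; case: cid => t []. Qed.

Let chi_mid S s t : generic t -> spans s t -> chi S s t = chi S s (mid s).
Proof.
move=> gt st; rewrite /chi (upper_transport gt (@mid_generic s) st (@mid_spans s)).
by rewrite (lower_transport gt (@mid_generic s) st (@mid_spans s)).
Qed.

(* Compare the vertical lines just before and just after [w0]. *)
Let chi_around S w0 :
  \big[addb/false]_(s : segment | chi S s (mid s)) ((start s == w0) (+) (stop s == w0)) = false.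
Proof.
have [pw0|npw0] := pselect (isPt w0); last first.
  rewrite big1 // => s _.
  have -> : (start s == w0) = false by apply/eqP => e; apply: npw0; rewrite -e.
  by apply/eqP => e; apply: npw0; rewrite -e.
have [d d0 dW] := gap w0; have [g1 g2] := generic_near pw0 d0 dW.
have wE w : isPt w -> (w == w0) = (X w < X w0 - d) (+) (X w < X w0 + d).
  move=> pw; have [->|ww0] := eqVneq w w0.
    have -> : (X w0 < X w0 - d) = false by apply/negbTE; rewrite -leNgt; lra.
    by have -> : X w0 < X w0 + d by lra.
  have := dW w pw; have [xx|xx] := eqVneq (X w) (X w0).
    by move/eqP: ww0; case; apply: injX.
  move=> /(_ (elimN eqP xx)); have [lt|le] := ltP (X w) (X w0).
    rewrite ltr0_norm ?subr_lt0 // => dlt.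
    have -> : X w < X w0 - d by lra.
    have -> // : X w < X w0 + d by lra.
  rewrite ger0_norm ?subr_ge0 // => dlt.
  have -> : (X w < X w0 - d) = false by apply/negbTE; rewrite -leNgt; lra.
  by apply/esym/negbTE; rewrite -leNgt; lra.
have := congr2 addb (chi_line S g2) (chi_line S g1); rewrite addbb.
rewrite big_mkcond [X in _ (+) X]big_mkcond -big_split /= => H.
rewrite -[RHS]H big_mkcond; apply: eq_bigr => s _.
rewrite !wE //.
have -> : (if spans s (X w0 - d) then chi S s (X w0 - d) else false) =
    spans s (X w0 - d) && chi S s (mid s).
  by case: ifP => //= st; apply: chi_mid.
have -> : (if spans s (X w0 + d) then chi S s (X w0 + d) else false) =
    spans s (X w0 + d) && chi S s (mid s).
  by case: ifP => //= st; apply: chi_mid.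
rewrite /spans -/(XA s) -/(XB s); case: (chi S s (mid s)); last by rewrite !andbF.
by rewrite !andbT addbACA.
Qed.

Lemma size_path e : (0 < size (l e))%N.
Proof.
rewrite lt0n size_eq0; apply/eqP => le; have := polygonal_last L e.
by rewrite le /= => /ipos; apply: loopfree.
Qed.

Definition first e : segment := existT (fun e => 'I_(size (l e))) e (Ordinal (size_path e)).

Let path_uniq e : uniq (path e). Proof. exact: simple_uniq (polygonal_simple L e). Qed.

Let inner_point e k e' j : (0 < k < size (l e))%N -> (j <= size (l e'))%N ->
  nth x0 (path e') j = nth x0 (path e) k -> e' = e /\ j = k.
Proof.
move=> /andP[k0 kl] jl w.
have kin : (k < size (path e))%N by rewrite /= ltnS ltnW.
have ee : e' = e.
  apply: contrapT => ne.
  have pz : poly (pos (e1 e')) (l e') (nth x0 (path e) k).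
    by rewrite -w; apply: mem_poly; rewrite mem_nth.
  have pz' : poly (pos (e1 e)) (l e) (nth x0 (path e) k).
    by apply: mem_poly; rewrite mem_nth.
  have [v vE] := polygonal_disj L ne pz pz'.
  rewrite vE in pz'; have [v1|v2] := polygonal_pos L pz'.
    have : nth x0 (path e) k = nth x0 (path e) 0 by rewrite vE v1.
    by move=> /eqP; rewrite (nth_uniq x0 kin (ltn0Sn _) (@path_uniq e)); case: (k) k0.
  have : nth x0 (path e) k = nth x0 (path e) (size (l e)).
    by rewrite vE v2 -(polygonal_last L) (last_nth x0).
  by move=> /eqP; rewrite (nth_uniq x0 kin (ltnSn _) (@path_uniq e)) => /eqP kE; move: kl; rewrite kE ltnn.
subst e'; split=> //; have jin : (j < size (path e))%N by rewrite /= ltnS.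
by apply/eqP; rewrite -(nth_uniq x0 jin kin (@path_uniq e)) w.
Qed.

(** At an inner vertex of a polygon only two segments meet, and [chi_around] forces them to have the
    same [chi]. So the cuts of the dual do not depend on which segment of an edge is used. *)
Let chi_first S s : chi S s (mid s) = chi S (first (tag s)) (mid (first (tag s))).
Proof.
case: s => e [i il] /=; elim: i il => [|i IH] il.
  by congr (chi S _ (mid _)); congr existT; apply: val_inj.
rewrite -(IH (ltnW il)) /=.
set s1 := existT _ e (Ordinal (ltnW il)); set s2 := existT _ e (Ordinal il).
have s12 : s2 != s1.
  by apply/eqP => /(congr1 (fun s : segment => val (tagged s))) /= /eqP; rewrite eqn_leq ltnn.
have w12 : stop s1 = start s2 by [].
have := chi_around S (start s2).
rewrite big_mkcond (bigD1 s1) //= (bigD1 s2) //= big1 ?addbF; last first.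
  move=> [e' j] /andP[n1 n2]; case: ifP => // _.
  have iP : (0 < i.+1 < size (l e))%N by [].
  have -> : (start (existT _ e' j) == start s2) = false.
    apply/eqP => /(inner_point iP (ltnW (ltn_ord j)))[ee jE]; subst e'.
    by case/eqP: n2; congr existT; apply: val_inj.
  apply/eqP => /(@inner_point e i.+1 e' j.+1 iP (ltn_ord j))[ee [jE]]; subst e'.
  by case/eqP: n1; congr existT; apply: val_inj.
have /negPf -> : start s1 != start s2.
  by rewrite -w12; apply/eqP/start_neq_stop.
have /negPf -> : stop s2 != start s2 by rewrite eq_sym; apply/eqP/start_neq_stop.
rewrite w12 eqxx /=.
by case: (chi S s1 _); case: (chi S s2 _).
Qed.

Lemma dual_graph : exists p q : E -> {ffun {set E} -> bool},
  (forall S, even_edges e1 e2 [set e | crosses p q S e]%SET) /\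
  (forall Z, even_edges e1 e2 Z ->
     exists S : {set {ffun {set E} -> bool}}, forall e, crosses p q S e = (e \in Z)).
Proof.
exists (fun e => upper (first e) (mid (first e))), (fun e => lower (first e) (mid (first e))).
split=> [S|Z Ze].
  apply/forallP => v; apply/negbT; rewrite -[RHS](chi_around S (pos v)).
  rewrite (eq_bigl (fun s : segment => tag s \in
    [set e | crosses (fun e => upper (first e) (mid (first e)))
              (fun e => lower (first e) (mid (first e))) S e]%SET)); last first.
    by move=> s; rewrite chi_first finset.in_set.
  rewrite (sum_segments _ (fun w => w == pos v)); apply: eq_bigr => e _.
  by rewrite /incident !(inj_eq ipos).
(* The faces around which [Z] winds oddly: crossing [e] changes this parity exactly when [e] is in
   [Z]. *)
exists [set f : {ffun {set E} -> bool} | f Z]%SET => e.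
by rewrite /crosses !finset.in_set lowerE // addbA addbb.
Qed.

End DualOfDrawing.

(** * Cuts and colorings *)

Lemma average_cut (R : realType) (V E : finType) (e1 e2 : E -> V)
    (pos : V -> R * R) (arc : E -> R -> R * R) :
  (forall e, e1 e <> e2 e) -> injective pos -> draws e1 e2 pos arc ->
  exists (I : finType) (w : I -> R) (A : I -> {set V}),
    [/\ forall i, 0 <= w i, \sum_i w i = 1 &
      forall e, 2 / 3 <= \sum_(i | (e1 e \in A i) (+) (e2 e \in A i)) w i].
Proof.
move=> lf ipos /(polygonal_drawing lf ipos)[{}arc [l [_ L]]].
have [eps epsP] := generic_shear (flatten [seq pos (e1 e) :: l e | e <- enum E]).
have [|p [q [even_cross cross_even]]] := dual_graph lf ipos L (eps := eps).
  move=> w w' [e we] [e' we']; apply: epsP; apply/flatten_mapP.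
    by exists e; rewrite ?mem_enum.
  by exists e'; rewrite ?mem_enum.
(* The parity of the degree in the dual, so that a set is odd for [T] exactly when its cut has odd
   size. *)
pose T f := \big[addb/false]_e ((p e == f) (+) (q e == f)).
have oddT S : odd_set T S = \big[addb/false]_e crosses p q S e.
  rewrite /odd_set /T exchange_big; apply: eq_bigr => e _.
  rewrite big_split /= /crosses; congr (_ (+) _).
    by rewrite big_mkcond (bigD1 (p e)) //= eqxx big1 ?addbF => [|f /negPf];
      [case: ifP|rewrite eq_sym => ->; case: ifP].
  by rewrite big_mkcond (bigD1 (q e)) //= eqxx big1 ?addbF => [|f /negPf];
    [case: ifP|rewrite eq_sym => ->; case: ifP].
have fx : feasible p q T (fun=> 3^-1 : R).
  split=> [e|S]; first by rewrite invr_ge0.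
  rewrite oddT => oS; rewrite sumr_const -[_ *+ _]mulr_natl.
  rewrite ler_pdivlMr // mul1r ler_nat.
  have := big_addb_odd [set: E]%SET (crosses p q S).
  have -> : \big[addb/false]_(e in [set: E]%SET) crosses p q S e = true.
    by rewrite -[RHS]oS; apply: eq_bigl => e; rewrite finset.in_setT.
  have -> : #|[set e in [set: E] | crosses p q S e]%SET| = #|crosses p q S|.
    by apply: eq_card => e; rewrite !finset.in_set.
  (* A cut of size 1 would be an even edge set consisting of a single edge that is not a loop. *)
  case n: #|crosses p q S| => [|[|[|m]]] // _.
  have /card1P[e0 He0] : #|crosses p q S| == 1%N by rewrite n.
  have ce e : crosses p q S e = (e == e0) by have := He0 e; rewrite !inE.
  have /forallP/(_ (e1 e0)) := even_cross S.
  rewrite (eq_bigl (pred1 e0)); last by move=> e; rewrite finset.in_set ce.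
  rewrite big_pred1_eq /incident eqxx eq_sym.
  by case: eqP => // /lf.
have [I [w [K [w0 w1 wJ wx]]]] := feasible_dominates fx.
have /choice[A AP] : forall i, exists A : {set V},
    0 < w i -> forall e, (e \notin K i) = (e1 e \in A) (+) (e2 e \in A).
  (* Members of weight 0 are under no parity condition and get an arbitrary cut. *)
  move=> i; have [wi|wi] := pselect (0 < w i); last by exists finset.set0.
  (* On the dual cut [Z] a T-join has the parity of [Z] itself, so its complement meets [Z]
     evenly. *)
  have [|A HA] := @cut_of_orthogonal _ _ e1 e2 (finset.setC (K i)).
    move=> Z /cross_even[S SZ].
    have := wJ i S wi Logic.I; rewrite /join_at oddT => H.
    rewrite -(eq_bigr _ (fun e _ => SZ e)).
    under eq_bigl do rewrite finset.in_setC.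
    move: H; rewrite [RHS](bigID (fun e => e \in K i)) /=.
    by case: (\big[_/_]_(e in K i) _); case: (\big[_/_]_(e | e \notin K i) _).
  by exists A => _ e; rewrite -HA finset.in_setC.
exists I, w, A; split=> // e.
have -> : \sum_(i | (e1 e \in A i) (+) (e2 e \in A i)) w i = \sum_(i | e \notin K i) w i.
  rewrite big_mkcond [RHS]big_mkcond; apply: eq_bigr => i _.
  have := w0 i; rewrite le_eqVlt => /predU1P[<-|wi]; first by do 2!case: ifP.
  by rewrite AP.
have := w1; rewrite (bigID (fun i => e \in K i)) /= => ws.
by have := wx e; lra.
Qed.

(** * Lattice points of the cut polytope *)

Section Cuts.
Variables (R : realType) (G : mgraph).
Local Notation V := (vertex G).
Local Notation cut A := (@cut_vector R G A).

Lemma cutE (A : {set V}) e : cut A e = ((end1 e \in A) (+) (end2 e \in A))%:R.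
Proof. by rewrite ffunE; case: (end1 e \in A); case: (end2 e \in A). Qed.

Lemma cut_polytope_family (I : finType) (w : I -> R) (A : I -> {set V})
    (x : {ffun edge G -> R}) :
  (forall i, 0 <= w i) -> \sum_i w i = 1 ->
  (forall e, x e = \sum_i w i * cut (A i) e) -> cut_polytope x.
Proof.
move=> w0 w1 xE; exists (fun B => \sum_(i | A i == B) w i); split.
- by move=> B; apply: sumr_ge0.
- by rewrite -w1 [RHS](partition_big A predT).
- move=> e; rewrite xE (partition_big A predT) //=; apply: eq_bigr => B _.
  by rewrite mulr_suml; apply: eq_bigr => i /eqP ->.
Qed.

Lemma cut_polytope_bounds (x : {ffun edge G -> R}) e : cut_polytope x -> 0 <= x e <= 1.
Proof.
move=> [lam [lam0 lam1 ->]]; apply/andP; split.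
  by apply: sumr_ge0 => A _; rewrite cutE mulr_ge0.
rewrite -lam1; apply: ler_sum => A _; rewrite cutE.
by case: (_ (+) _); rewrite ?mulr1 ?mulr0.
Qed.

Lemma cut_in_lattice_polytope (A : {set V}) : dilate_lattice_points 1 (cut A).
Proof.
split.
  exists (cut A); last by rewrite mulr1n.
  apply: (@cut_polytope_family unit (fun=> 1) (fun=> A)) => //.
    by rewrite big_const card_unit /= addr0.
  by move=> e; rewrite big_const card_unit /= addr0 mul1r.
exists (fun B => (B == A)%:Z); rewrite (bigD1 A) //= eqxx big1 ?addr0 ?mulr1z //.
by move=> B /negPf ->; rewrite mulr0z.
Qed.

Definition oddz (m : int) : bool := odd `|m|%N.

Lemma oddzD m n : oddz (m + n) = oddz m (+) oddz n.
Proof. by rewrite /oddz; lia. Qed.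

Lemma oddz_half m : exists k : int, m = (oddz m)%:Z + 2 * k.
Proof. by exists (m %/ 2)%Z; rewrite /oddz; lia. Qed.

(** Modulo 2 a sum of cut vectors is the cut vector of a symmetric difference, here of the sets with
    odd coefficient. *)
Lemma cut_lattice_parity (x : {ffun edge G -> R}) : cut_lattice x ->
  exists (D : {set V}) (k : edge G -> int), forall e, x e = cut D e + 2 * (k e)%:~R.
Proof.
move=> [c ->]; pose D := [set v | \big[addb/false]_A (oddz (c A) && (v \in A))]%SET.
pose xz e := \sum_(A : {set V} | (end1 e \in A) (+) (end2 e \in A)) c A.
exists D; have /choice[k kP] := fun e => oddz_half (xz e).
exists k => e; have -> : (\sum_A cut A *~ c A) e = (xz e)%:~R.
  rewrite sum_ffunE rmorph_sum /= [RHS]big_mkcond; apply: eq_bigr => A _.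
  rewrite ffunMzE cutE; case: (_ (+) _) => //.
  by rewrite mul0rz.
rewrite {1}kP rmorphD rmorphM /= cutE; congr (_ %:R + _); congr nat_of_bool.
rewrite /xz (big_morph oddz oddzD (erefl : oddz 0 = false)) !finset.in_set -big_split /=.
rewrite big_mkcond; apply: eq_bigr => A _.
by case: (end1 e \in A); case: (end2 e \in A); case: (oddz _).
Qed.

Lemma lattice_point_cut (x : {ffun edge G -> R}) : dilate_lattice_points 1 x ->
  exists D : {set V}, x = cut D.
Proof.
move=> [[y py yx] /cut_lattice_parity[D [k xE]]]; exists D; apply/ffunP => e.
rewrite mulr1n in yx; subst y; have := cut_polytope_bounds e py; rewrite xE.
suff H : 0 <= cut D e + 2 * (k e)%:~R <= 1 -> k e = 0.
  by move=> /H ->; rewrite mulr0z mulr0 addr0.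
rewrite cutE => /andP[h1 h2].
have [k1 k2] : ((-1)%:~R : R) < (k e)%:~R /\ (k e)%:~R < (1%:~R : R).
  by split; move: h1 h2; rewrite ?mulrN1z ?mulr1z; case: (_ (+) _) => /=; lra.
by move: k1 k2; rewrite !ltr_int; lia.
Qed.

End Cuts.

(* The colors are the elements of F_2^2, and the bits its nonzero linear forms. *)
Definition color_bit (j : 'I_3) (c : 'I_4) : bool :=
  match val j with 0%N => odd c | 1%N => (1 < c)%N | _ => odd c (+) (1 < c)%N end.

Lemma sum_color_bits (R : pzSemiRingType) (c c' : 'I_4) :
  \sum_(j < 3) (color_bit j c (+) color_bit j c')%:R = (2 * (c != c'))%:R :> R.
Proof.
rewrite -natr_sum; congr (_%:R); rewrite !big_ord_recl big_ord0 /color_bit /=.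
by case: c => [[|[|[|[|]]]] ?] //; case: c' => [[|[|[|[|]]]] ?].
Qed.

Definition color_class (V : finType) (c : V -> 'I_4) (j : 'I_3) : {set V} :=
  [set v | color_bit j (c v)]%SET.

(** * The two implications *)

Section MainDirections.
Variable R : realType.

Lemma sum_color_cuts (G : mgraph) (c : vertex G -> 'I_4) e :
  \sum_(j < 3) cut_vector R (color_class c j) e = (2 * (c (end1 e) != c (end2 e)))%:R.
Proof.
rewrite -sum_color_bits; apply: eq_bigr => j _.
by rewrite cutE !finset.in_set.
Qed.

(** The sum of the stars of all vertices: an edge that is not a loop lies in exactly two of them. *)
Lemma double_in_cut_lattice (G : mgraph) : loopless G ->
  @cut_lattice R G [ffun=> 2].
Proof.
move=> Gl; exists (fun A => \sum_v (A == [set v]%SET)%:Z).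
under eq_bigr do rewrite mulrz_sumr.
rewrite exchange_big /=; apply/ffunP => e; rewrite ffunE sum_ffunE.
rewrite (eq_bigr (fun v => (end1 e == v)%:R + (end2 e == v)%:R)).
  rewrite big_split /= (bigD1 (end1 e)) //= eqxx big1 ?addr0; last first.
    by move=> v /negPf; rewrite eq_sym => ->.
  rewrite (bigD1 (end2 e)) //= eqxx big1 ?addr0 // => v /negPf.
  by rewrite eq_sym => ->.
move=> v _; rewrite (bigD1 [set v]%SET) //= eqxx big1 => [|A /negPf->]; last by rewrite mulr0z.
rewrite addr0 mulr1z cutE !finset.in_set1; have := Gl e.
have [->|] := eqVneq (end1 e) v; last by case: eqP => _; rewrite ?add0r ?addr0.
by rewrite eq_sym => /negPf ->; rewrite addr0.
Qed.

(** Two of the three cuts make up the color. If neither separated the ends of [e], the third alone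
    would have to contribute 2. *)
Lemma coloring_of_triple (G : mgraph) (D : 'I_3 -> {set vertex G}) :
  (forall e, 2 = \sum_(i < 3) cut_vector R (D i) e) -> four_colorable G.
Proof.
move=> D2; pose c v : 'I_4 := inord ((v \in D ord0) + 2 * (v \in D (inord 1)))%N.
exists c => e; apply/eqP => ce; have := D2 e.
have := congr1 (fun x : 'I_4 => x : nat) ce; rewrite /c /= !inordK; last first.
  - by case: (_ \in _); case: (_ \in _).
  - by case: (_ \in _); case: (_ \in _).
have i1 : lift ord0 ord0 = inord 1 :> 'I_3 by apply: val_inj; rewrite /= inordK.
rewrite !big_ord_recl big_ord0 !cutE addr0 i1.
set a0 := end1 e \in D ord0; set b0 := end2 e \in D ord0.
set a1 := end1 e \in D (inord 1); set b1 := end2 e \in D (inord 1).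
move=> ab; have [-> ->] : a0 = b0 /\ a1 = b1.
  by move: ab; case: a0; case: b0; case: a1; case: b1.
rewrite !addbb !add0r; case: (_ (+) _) => /eqP; last by rewrite pnatr_eq0.
by rewrite -[X in _ == X]/(1%:R) eqr_nat.
Qed.

Lemma four_colorable_of_normal :
  (forall G : mgraph, loopless G -> planar R G ->
     forall x : {ffun edge G -> R}, dilate_lattice_points 3 x ->
     exists y : 'I_3 -> {ffun edge G -> R},
       (forall i, dilate_lattice_points 1 (y i)) /\ x = \sum_(i < 3) y i) ->
  forall G : mgraph, loopless G -> planar R G -> four_colorable G.
Proof.
move=> normal G; have [n] := ubnP #|edge G|; elim: n => // n IH in G *.
rewrite ltnS => leGn Gl Gp.
have [pos [arc [ipos D]]] := (planar_draws R G).1 Gp.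
have lf e : end1 e <> end2 e :> vertex G by apply/eqP; apply: Gl.
have /choice[col colP] : forall e : edge G, exists c : vertex G -> 'I_4,
    forall f, f != e -> c (end1 f) != c (end2 f).
  move=> e; pose H := @MGraph (vertex G) {f : edge G | f != e}
    (fun f => end1 (val f)) (fun f => end2 (val f)).
  have [|||c cP] := IH H.
  - apply: leq_trans leGn; rewrite /= card_sig -(cardC (pred1 e)) card1 add1n ltnS.
    by apply: subset_leq_card; apply/fintype.subsetP => f.
  - by move=> f; exact: (Gl (val f)).
  - apply/planar_draws; exists pos, (fun f => arc (val f)); split=> //; split.
    + by move=> f; apply: (draws_cts D).
    + by move=> f; apply: (draws_0 D).
    + by move=> f; apply: (draws_1 D).
    + by move=> f s t; apply: (draws_inj D).
    + by move=> f w t; apply: (draws_pos D).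
    + by move=> f g s t fg; apply: (draws_arc D) => /val_inj.
  by exists c => f fe; apply: (cP (exist _ f fe)).
have [[e0 ne0]|alle] := pselect (exists e, col e (end1 e) != col e (end2 e)).
  by exists (col e0) => f; have [->//|fe] := eqVneq f e0; apply: colP.
(* From here on each [col e] fails at [e] and nowhere else, so the sum of its three cuts is known
   exactly. *)
have colE e f : (col e (end1 f) != col e (end2 f)) = (f != e).
  have [->|fe] := eqVneq f e; last exact: colP.
  by apply/negbTE/negP => ne; apply: alle; exists e.
have [I [w [A [w0 w1 wz]]]] := average_cut lf ipos D.
pose z e := \sum_(i | (end1 e \in A i) (+) (end2 e \in A i)) w i.
pose s := \sum_e (z e - 2 / 3).
have s0 : 0 <= s by apply: sumr_ge0 => e _; rewrite subr_ge0; apply: wz.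
(* The coloring of G - e has average cut 2/3 off e and 0 on e, so the excess of
   z over 2/3 at e can be compensated separately for each edge. *)
pose al := (1 + 3 / 2 * s)^-1.
have d0 : 0 < 1 + 3 / 2 * s by rewrite ltr_pwDl // mulr_ge0.
have al0 : 0 <= al by rewrite invr_ge0 ltW.
(* Each of the three cuts of [col e] receives the weight [be e]. They add up to 2 off [e], whence
   the division by 2. The weights sum to [al + 3 / 2 * (al * s) = 1], and the value at every edge
   becomes [al * (s + 2 / 3) = 2 / 3]. *)
pose be e := al * (z e - 2 / 3) / 2.
have be0 e : 0 <= be e by rewrite divr_ge0 // mulr_ge0 // subr_ge0; apply: wz.
have sbe : \sum_e be e = al * s / 2 by rewrite -mulr_suml -mulr_sumr.
have als : al + 3 / 2 * (al * s) = 1.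
  by rewrite -[RHS](mulVf (lt0r_neq0 d0)) -/al; ring.
have cutz e : \sum_i w i * cut_vector R (A i) e = z e.
  rewrite /z [RHS]big_mkcond; apply: eq_bigr => i _; rewrite cutE.
  by case: (_ (+) _); rewrite ?mulr1 ?mulr0.
have [] := normal G Gl Gp [ffun=> 2].
  split; last exact: double_in_cut_lattice.
  exists [ffun=> 2 / 3]; last by apply/ffunP => e; rewrite ffunMnE !ffunE -mulr_natr; field.
  apply: (@cut_polytope_family R G (I + edge G * 'I_3)%type
    (fun i => match i with inl i => al * w i | inr p => be p.1 end)
    (fun i => match i with inl i => A i | inr p => color_class (col p.1) p.2 end)).
  - by case=> [i|p] /=; [rewrite mulr_ge0|exact: be0].
  - rewrite big_sumType /= -mulr_sumr w1 mulr1.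
    rewrite -(pair_bigA _ (fun e (_ : 'I_3) => be e)) /=.
    under eq_bigr do rewrite sumr_const card_ord -mulr_natr.
    by rewrite -mulr_suml sbe; lra.
  - move=> e; rewrite ffunE big_sumType /=.
    under eq_bigr do rewrite -mulrA.
    rewrite -mulr_sumr cutz.
    rewrite -(pair_bigA _ (fun f (j : 'I_3) => be f * cut_vector R (color_class (col f) j) e)) /=.
    under [X in _ + X]eq_bigr do rewrite -mulr_sumr sum_color_cuts colE.
    have -> : \sum_f be f * (2 * (e != f))%:R = 2 * (\sum_f be f - be e).
      rewrite (bigD1 e) //= eqxx mulr0 add0r [X in 2 * (X - _)](bigD1 e) //= addBK.
      rewrite mulr_sumr; apply: eq_bigr => f fe.
      by rewrite eq_sym fe muln1 mulrC.
    by rewrite sbe /be; lra.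
move=> y [yP xy].
have /choice[B BP] : forall i, exists B : {set vertex G}, y i = cut_vector R B.
  by move=> i; apply: lattice_point_cut; apply: yP.
apply: (@coloring_of_triple G B) => e.
have /ffunP/(_ e) := xy; rewrite ffunE sum_ffunE => ->.
by apply: eq_bigr => i _; rewrite BP.
Qed.

Lemma normal_of_four_colorable :
  (forall G : mgraph, loopless G -> planar R G -> four_colorable G) ->
  forall G : mgraph, loopless G -> planar R G ->
     forall x : {ffun edge G -> R}, dilate_lattice_points 3 x ->
     exists y : 'I_3 -> {ffun edge G -> R},
       (forall i, dilate_lattice_points 1 (y i)) /\ x = \sum_(i < 3) y i.
Proof.
move=> col G Gl Gp x [[y [lam [lam0 lam1 yE]] yx] /cut_lattice_parity[D [k xE]]].
pose mu A := lam (symd A D).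
have symdK : involutive (fun A : {set vertex G} => symd A D).
  by move=> A; apply/setP => v; rewrite !inE -addbA addbb addbF.
have cut_symd (A : {set vertex G}) e : cut_vector R (symd A D) e =
    if (end1 e \in D) (+) (end2 e \in D) then 1 - cut_vector R A e else cut_vector R A e.
  rewrite !cutE !inE addbACA; case: ((end1 e \in D) (+) _); last by rewrite addbF.
  by case: (end1 e \in A); case: (end2 e \in A); rewrite /= ?subrr ?subr0.
pose x' e := \sum_A mu A * cut_vector R A e.
have x3 e : x e = 3 * \sum_A lam A * cut_vector R A e.
  by rewrite -yx ffunMnE yE mulr_natl.
have x'E e : x' e = \sum_A lam A * cut_vector R (symd A D) e.
  rewrite /x' (reindex_inj (inv_inj symdK)) /=; apply: eq_bigr => A _.
  by rewrite /mu symdK.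
have x'S e : 3 * x' e = if (end1 e \in D) (+) (end2 e \in D) then 3 - x e else x e.
  rewrite x'E x3; under eq_bigr do rewrite cut_symd; case: ifP => // _.
  under eq_bigr do rewrite mulrBr mulr1.
  by rewrite big_split /= sumrN lam1 mulrBr mulr1.
have mu0 A : 0 <= mu A by apply: lam0.
have x'01 e : 0 <= x' e <= 1.
  rewrite x'E; apply/andP; split; first by apply: sumr_ge0 => A _; rewrite cutE mulr_ge0.
  by rewrite -lam1; apply: ler_sum => A _; rewrite cutE; case: (_ (+) _); rewrite ?mulr1 ?mulr0.
(* Two vertices have equal labels when no cut of positive weight separates them. This is an
   equivalence on vertices, and on the ends of an edge it means that [x'] vanishes there, so it can
   direct the contraction. *)
pose h v := [set A | (0 < mu A) && (v \in A)]%SET.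
have hE e : (h (end1 e) == h (end2 e)) = (x' e == 0).
  apply/eqP/eqP => [hh|x0].
    rewrite /x' big1 // => A _; have := mu0 A; rewrite le_eqVlt => /predU1P[<-|muA].
      by rewrite mul0r.
    move/setP/(_ A): hh; rewrite !finset.in_set muA /= => AA.
    by rewrite cutE AA addbb mulr0.
  apply/setP => A; rewrite !finset.in_set; case muA: (0 < mu A) => //=.
  have /psumr_eq0P H : x' e = 0 by [].
  have /eqP : mu A * cut_vector R A e = 0.
    by apply: H => // B _; rewrite cutE mulr_ge0.
  rewrite mulf_eq0 gt_eqF //= cutE; case: (_ \in A); case: (_ \in A) => //=;
  by rewrite oner_eq0.
have [c cP] := relative_coloring col h Gl Gp.
(* An even integer between 0 and 3 is 0 or 2. *)
have x'2 e : 3 * x' e = (2 * (c (end1 e) != c (end2 e)))%:R.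
  have int2 : exists j : int, 3 * x' e = 2 * j%:~R.
    rewrite x'S xE cutE; case: (_ (+) _); last by exists (k e); rewrite add0r.
    by exists (1 - k e); rewrite rmorphB /=; lra.
  rewrite cP hE; case: eqP => [->|/eqP x0]; first by rewrite mulr0.
  have [j jE] := int2; rewrite jE; have /andP[x0' x1] := x'01 e.
  have {}x0 : 0 < x' e by rewrite lt_def x0.
  have [j1 j2] : (0%:~R : R) < j%:~R /\ j%:~R < (2%:~R : R).
    by split; rewrite ?mulr0z -?pmulrn; lra.
  have -> : j = 1 by move: j1 j2; rewrite !ltr_int; lia.
  by rewrite mulr1z mulr1.
(* Switching back at [D]: where [D] separates the ends of an edge, the three values are complemented
   and their sum [3 * x' e] becomes [3 - 3 * x' e]. *)
exists (fun j => cut_vector R (symd (color_class c j) D)); split.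
  by move=> j; apply: cut_in_lattice_polytope.
apply/ffunP => e; rewrite sum_ffunE.
under eq_bigr do rewrite cut_symd.
have := x'S e; rewrite x'2 -(sum_color_cuts c); case: ifP => _ S.
  rewrite big_split /= sumrN S sumr_const card_ord -mulr_natr mul1r; lra.
by rewrite S.
Qed.

End MainDirections.

Theorem theorem3 (R : realType) :
  (forall G : mgraph, loopless G -> planar R G ->
     forall x : {ffun edge G -> R}, dilate_lattice_points 3 x ->
     exists y : 'I_3 -> {ffun edge G -> R},
       (forall i, dilate_lattice_points 1 (y i)) /\ x = \sum_(i < 3) y i)
  <->
  (forall G : mgraph, loopless G -> planar R G -> four_colorable G).
Proof.
by split; [exact: four_colorable_of_normal|exact: normal_of_four_colorable].
Qed.
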